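(* Let $\mu$ be a probability measure on $\mathbb{C}$ with compact support, and let $X_1, X_2, \ldots$ be iid random variables with distribution $\mu$. For each $n \ge 1$ let $\xi_1^{(n)}, \ldots, \xi_{k_n}^{(n)}$ be deterministic complex numbers, where $k_n \le K$ for some constant $K$ independent of $n$, and assume $\max\{|\xi_1^{(n)}|, \ldots, |\xi_{k_n}^{(n)}|\} \le B$ for some constant $B$ independent of $n$. Fix $\varepsilon > 0$ and a nonnegative integer $s$, and suppose that for all sufficiently large $n$: none of $\xi_1^{(n)}, \ldots, \xi_{k_n}^{(n)}$ lies in $N_\mu(3\varepsilon)\setminus N_\mu(\varepsilon)$, the $s$ values $\xi_1^{(n)}, \ldots, \xi_s^{(n)}$ lie outside $N_\mu(3\varepsilon)$, and the remaining values $\xi_{s+1}^{(n)},\ldots,\xi_{k_n}^{(n)}$ lie in $N_\mu(\varepsilon)$. Then, almost surely, for all sufficiently large $n$, the polynomial \[ p_n(z) := \prod_{j=1}^{n-k_n} (z - X_j) \prod_{l=1}^{k_n} (z - \xi_l^{(n)}) \] has exactly $s$ critical points (counted with multiplicity) outside $N_\mu(2\varepsilon)$, and these can be labeled $w_1(p_n), \ldots, w_s(p_n)$ so that $\max_{1 \le l \le s}|w_l(p_n) - \xi_l^{(n)}| \to 0$ as $n\to\infty$.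
   Context: For a probability measure $\mu$ on $\mathbb{C}$, $m_\mu(z) := \int_{\mathbb{C}} \frac{d\mu(x)}{z-x}$ for $z \notin \operatorname{supp}(\mu)$; $M_\mu := \{ z \in \mathbb{C}\setminus \operatorname{supp}(\mu) : m_\mu(z) = 0\}$; and $N_\mu(\varepsilon) := \{ z \in \mathbb{C} : \operatorname{dist}(z, \operatorname{supp}(\mu) \cup M_\mu) < \varepsilon\}$. A critical point of a polynomial is a zero of its derivative. *)

(* Defs.v *)
From HB Require Import structures.
From mathcomp Require Import all_boot all_order all_algebra.
From mathcomp Require Import all_classical all_reals all_analysis.
From mathcomp.real_closed Require Import complex.
Import numFieldNormedType.Exports.

Set Implicit Arguments.
Unset Strict Implicit.
Unset Printing Implicit Defensive.

Import Order.TTheory GRing.Theory Num.Theory.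
Local Open Scope classical_set_scope.
Local Open Scope ring_scope.

Section Defs.
Variable R : realType.

(* The complex plane C is R[i]; for measure-theoretic purposes points of C
   are represented as pairs in R * R (Borel product sigma-algebra, product
   topology), identified with R[i] via [toC]. *)
Definition toC (x : R * R) : R[i] := Complex x.1 x.2.

Definition cabs (z : R[i]) : R := Normc.normc z.

Definition supp (mu : probability (R * R)%type R) : set (R * R) :=
  [set x | forall U : set (R * R), open U -> U x -> (0 < mu U)%E].

Definition suppC (mu : probability (R * R)%type R) : set R[i] :=
  toC @` supp mu.

Definition cauchy_transform (mu : probability (R * R)%type R) (z : R[i]) : R[i] :=
  Complex (Rintegral mu setT (fun x => complex.Re ((z - toC x)^-1)))
          (Rintegral mu setT (fun x => complex.Im ((z - toC x)^-1))).

Definition Mset (mu : probability (R * R)%type R) : set R[i] :=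
  [set z | ~ suppC mu z /\ cauchy_transform mu z = 0].

Definition Nmu (mu : probability (R * R)%type R) (eps : R) : set R[i] :=
  [set z | exists y, (suppC mu y \/ Mset mu y) /\ cabs (z - y) < eps].

Definition iid_with {d} {T : measurableType d} (P : probability T R)
    (mu : probability (R * R)%type R) (X : nat -> T -> R * R) : Prop :=
  (forall i, measurable_fun setT (X i)) /\
  forall (I : seq nat) (A : nat -> set (R * R)),
    uniq I -> (forall i, measurable (A i)) ->
    P (\bigcap_(i in [set` I]) (X i @^-1` A i)) =
    ((\prod_(i <- I) fine (mu (A i)))%:E).

(* p_n(z) = prod_{j=1}^{n-k_n} (z - X_j) prod_{l=1}^{k_n} (z - xi_l^(n));
   indices are shifted to start at 0. *)
Definition pn {d} {T : measurableType d} (X : nat -> T -> R * R)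
    (k : nat -> nat) (xi : nat -> nat -> R[i]) (n : nat) (w : T) : {poly R[i]} :=
  (\prod_(j < n - k n) ('X - (toC (X j w))%:P)) *
  (\prod_(l < k n) ('X - (xi n l)%:P)).

Definition critical_labeling (p : {poly R[i]}) (mu : probability (R * R)%type R)
    (r : R) (s : nat) (wl : seq R[i]) : Prop :=
  [/\ size wl = s, p^`() != 0,
      (forall z, z \in wl -> ~ Nmu mu r z) &
      (forall z, ~ Nmu mu r z -> mup z p^`() = count_mem z wl)].

End Defs.

(* Main.v *)
Require Import Defs.
From HB Require Import structures.
From mathcomp Require Import all_boot all_order all_algebra.
From mathcomp Require Import all_classical all_reals all_analysis.
From mathcomp Require Import measurable_realfun.
From mathcomp.real_closed Require Import complex.
From mathcomp Require Import zify ring lra.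
Import numFieldNormedType.Exports.
Import Order.TTheory GRing.Theory Num.Theory.
Local Open Scope classical_set_scope.
Local Open Scope ring_scope.

(* Write p_n = A Q, where A collects the factors z - xi_l with l < s, and let
   G = Q'/Q be the sum of 1/(z - a) over the roots a of Q. By the law of large
   numbers G/n is almost surely uniformly close to m_mu on the bounded part of the
   complement of N(2 eps), where |m_mu| is bounded below; hence |G| >= c n there.

   Instead of Rouche's theorem, the roots are followed along the segment from
   (Q' A)/deg Q to p_n'/n. Every polynomial on it is proportional to
   Q' A + t Q A' with 0 <= t <= 1, so a root z outside N(2 eps) satisfies
   A G + t A' = 0, and therefore lies within s/(c n) of some xi_l. By continuity
   of roots they can be followed in steps as small as we like; the ones starting
   at xi_0, ..., xi_(s-1) cannot escape a neighbourhood of size O(1/n), and the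
   others, which start at zeros of Q', cannot leave N(2 eps).

   The law of large numbers is only needed for frequencies of events: the kernel
   1/(z - x) is uniformly approximated on the support by functions constant on
   the cells of a finite partition. *)

Set Implicit Arguments.
Unset Strict Implicit.
Unset Printing Implicit Defensive.

Local Arguments cabs : simpl never.

(** * Roots of complex polynomials *)
Section ComplexModulus.
Context {R : realType}.
Implicit Types (x y z : R[i]).

Lemma cabs0 : cabs (0 : R[i]) = 0. Proof. exact: Normc.normc0. Qed.
Lemma cabs1 : cabs (1 : R[i]) = 1. Proof. exact: Normc.normc1. Qed.
Lemma cabsN z : cabs (- z) = cabs z. Proof. exact: normcN. Qed.
Lemma cabsM x y : cabs (x * y) = cabs x * cabs y.
Proof. exact: Normc.normcM. Qed.
Lemma cabsV z : cabs z^-1 = (cabs z)^-1. Proof. exact: Normc.normcV. Qed.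
Lemma cabsD x y : cabs (x + y) <= cabs x + cabs y.
Proof. exact: le_normcD. Qed.
Lemma cabsB x y : cabs (x - y) = cabs (y - x).
Proof. by rewrite -cabsN opprB. Qed.
Lemma cabs_triangle y x z : cabs (x - z) <= cabs (x - y) + cabs (y - z).
Proof. by rewrite (_ : x - z = (x - y) + (y - z)) ?cabsD //; ring. Qed.
Lemma cabs_ge0 z : 0 <= cabs z.
Proof. by case: z => a b; exact: sqrtr_ge0. Qed.
Lemma cabs_eq0 z : (cabs z == 0) = (z == 0).
Proof.
by apply/eqP/eqP => [|->]; [exact: Normc.eq0_normc | exact: cabs0].
Qed.
Lemma cabs_gt0 z : (0 < cabs z) = (z != 0).
Proof. by rewrite lt_neqAle cabs_ge0 andbT eq_sym cabs_eq0. Qed.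
Lemma cabs_real (a : R) : cabs (real_complex R a) = `|a|.
Proof. by rewrite /cabs /= expr0n /= addr0 sqrtr_sqr. Qed.
Lemma cabs_sum (I : Type) (r : seq I) (Q : pred I) (F : I -> R[i]) :
  cabs (\sum_(i <- r | Q i) F i) <= \sum_(i <- r | Q i) cabs (F i).
Proof.
elim/big_ind2: _ => [|x1 x2 y1 y2 h1 h2|//]; first by rewrite cabs0.
by rewrite (le_trans (cabsD _ _)) // lerD.
Qed.
Lemma cabsX z n : cabs (z ^+ n) = cabs z ^+ n.
Proof. by elim: n => [|n IHn]; rewrite ?expr0 ?cabs1 // !exprS cabsM IHn. Qed.
Lemma Re_le_cabs z : `|complex.Re z| <= cabs z.
Proof.
case: z => a b; rewrite /cabs /= -sqrtr_sqr ler_wsqrtr //.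
by rewrite lerDl sqr_ge0.
Qed.
Lemma Im_le_cabs z : `|complex.Im z| <= cabs z.
Proof.
case: z => a b; rewrite /cabs /= -sqrtr_sqr ler_wsqrtr //.
by rewrite lerDr sqr_ge0.
Qed.
Lemma cabs_le z : cabs z <= `|complex.Re z| + `|complex.Im z|.
Proof.
case: z => a b; rewrite /cabs /= -[leRHS]ger0_norm ?addr_ge0 //.
rewrite -[leRHS]sqrtr_sqr ler_wsqrtr // sqrrD !real_normK ?num_real//.
by rewrite lerD2r lerDl mulrn_wge0 // mulr_ge0.
Qed.

Lemma cabs_prod (s : seq R[i]) z :
  cabs (\prod_(w <- s) ('X - w%:P)).[z] = \prod_(w <- s) cabs (z - w).
Proof.
elim: s => [|w s IHs]; first by rewrite !big_nil hornerC cabs1.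
by rewrite !big_cons hornerM cabsM IHs hornerXsubC.
Qed.

Lemma prod_cabs_lt (s : seq R[i]) z (e : R) : 0 <= e ->
  \prod_(w <- s) cabs (z - w) < e ^+ size s ->
  exists2 w, w \in s & cabs (z - w) < e.
Proof.
move=> e0; elim: s => [|w s IHs]; first by rewrite big_nil expr0 ltxx.
rewrite big_cons /= exprS; case: (ltP (cabs (z - w)) e) => [we _|ew].
  by exists w => //; rewrite mem_head.
case: (ltP (\prod_(w <- s) cabs (z - w)) (e ^+ size s)) => [/IHs[v vs ve] _|h].
  by exists v => //; rewrite inE vs orbT.
by rewrite ltNge ler_pM // exprn_ge0.
Qed.
End ComplexModulus.

(** * Continuous dependence of roots on coefficients *)

Section RootContinuity.
Context {R : realType}.
Local Notation C := R[i].
Local Notation rootpoly s := (\prod_(w <- s) ('X - w%:P) : {poly C}).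

Lemma cabs_horner_le (p : {poly C}) N (rho b : R) z :
  (size p <= N.+1)%N -> 1 <= b -> cabs z <= b ->
  (forall i, cabs p`_i <= rho) -> cabs p.[z] <= N.+1%:R * (rho * b ^+ N).
Proof.
move=> sp b1 zb pr; rewrite (horner_coef_wide _ sp).
apply: le_trans (cabs_sum _ _ _) _.
rewrite mulr_natl -[N.+1 in leRHS]card_ord -sumr_const.
apply: ler_sum => i _; rewrite cabsM cabsX.
apply: ler_pM; rewrite ?cabs_ge0 ?exprn_ge0 ?cabs_ge0 //.
apply: (@le_trans _ _ (b ^+ i)); first by rewrite lerXn2r ?nnegrE ?cabs_ge0 //; lra.
by rewrite ler_weXn2l // -ltnS.
Qed.

(** Synthetic division from the top: [D_i = p_(i+1) + z * D_(i+1)], and [D] has no coefficient from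
    index [N] on, so the bound follows by induction on the distance [j] down from [N]. *)
Lemma coef_divXsub_le (p D : {poly C}) N (rho b : R) z :
  p = ('X - z%:P) * D -> (size D <= N)%N -> 1 <= b -> cabs z <= b -> 0 <= rho ->
  (forall i, cabs p`_i <= rho) -> forall i, cabs D`_i <= N%:R * (rho * b ^+ N).
Proof.
move=> pE sD b1 zb rho0 pr.
have key j : forall i, (N <= i + j)%N -> cabs D`_i <= j%:R * (rho * b ^+ j).
  elim: j => [|j IHj] i.
    by rewrite addn0 => Ni; rewrite nth_default ?(leq_trans sD) // cabs0 mul0r.
  rewrite addnS -addSn => /IHj DS.
  have -> : D`_i = p`_i.+1 + z * D`_i.+1.
    by rewrite pE mulrBl coefB coefXM /= coefCM; ring.
  apply: le_trans (cabsD _ _) _; rewrite cabsM.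
  have bj : 1 <= b ^+ j.+1 by rewrite exprn_ege1.
  have : cabs z * cabs D`_i.+1 <= b * (j%:R * (rho * b ^+ j)).
    by apply: ler_pM; rewrite ?cabs_ge0.
  have : rho <= rho * b ^+ j.+1 by rewrite ler_peMr.
  have := pr i.+1; rewrite -natr1 exprS; nra.
by move=> i; apply: key; rewrite leq_addl.
Qed.

(** Each new factor ['X - w] multiplies the coefficient bound by at most [1 + b]. *)
Lemma coef_rootpoly_le (s : seq C) (b : R) : 0 <= b ->
  (forall w, w \in s -> cabs w <= b) ->
  forall i, cabs (rootpoly s)`_i <= (1 + b) ^+ size s.
Proof.
move=> b0; elim: s => [|w s IHs] sb i.
  rewrite big_nil coefC expr0; case: eqP => _; rewrite ?cabs1 ?cabs0 //.
have IH := IHs (fun v vs => sb v (mem_behead (s := w :: s) vs)).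
have wb := sb w (mem_head _ _).
rewrite big_cons mulrBl coefB coefXM coefCM /= exprS mulrDl mul1r.
apply: le_trans (cabsD _ _) _; rewrite cabsN cabsM lerD //.
  by case: eqP => // _; rewrite cabs0 exprn_ge0 //; lra.
by apply: ler_pM; rewrite ?cabs_ge0 ?IH.
Qed.

Lemma size_rootpoly (s : seq C) : size (rootpoly s) = (size s).+1.
Proof. by rewrite size_prod_XsubC. Qed.

Lemma size_rootpolyB (r s : seq C) N : size r = N -> size s = N ->
  (size (rootpoly r - rootpoly s)%R <= N)%N.
Proof.
move=> rN sN; apply/leq_sizeP => j; rewrite leq_eqVlt => /predU1P[<-|Nj].
  have lc (t : seq C) : size t = N -> (rootpoly t)`_N = 1.
    move=> tN; have := monicP (monic_prod_XsubC t xpredT (fun w : C => w)).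
    by rewrite /lead_coef size_rootpoly tN.
  by rewrite coefB !lc // subrr.
by rewrite coefB !nth_default ?subrr // size_rootpoly ?rN ?sN.
Qed.

(* A root of one polynomial almost annihilates the other, hence is close to one
   of its roots; dividing both out keeps the coefficients close. *)
Lemma roots_close (b : R) : 1 <= b -> forall N (eta : R), 0 < eta ->
  exists2 rho, 0 < rho & forall rs ws : seq C,
    size rs = N -> size ws = N ->
    (forall z, z \in rs -> cabs z <= b) -> (forall z, z \in ws -> cabs z <= b) ->
    (forall i, cabs (rootpoly rs - rootpoly ws)`_i <= rho) ->
    exists2 ws', perm_eq ws ws' &
      forall i, (i < N)%N -> cabs (rs`_i - ws'`_i) <= eta.
Proof.
move=> b1; elim => [|N IHN] eta eta0.
  by exists 1 => // rs ws /size0nil-> /size0nil-> _ _ _; exists [::].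
have [rho1 rho10 IH] := IHN _ eta0.
have b0 : 0 < b by lra.
set c := N%:R * b ^+ N + 1; set g := (1 + b) ^+ N.
have c0 : 0 < c by rewrite ltr_wpDl // mulr_ge0 ?exprn_ge0 // ltW.
have g0 : 0 < g by rewrite exprn_gt0 //; lra.
have c20 : 0 < 2 * c by rewrite mulr_gt0.
have cg20 : 0 < 2 * c * g by rewrite mulr_gt0.
(* Besides settling the first pair of roots, [e] is small enough for the correction [(w - z)] times
   the reduced polynomial to use only half of the budget [rho1]; [c] absorbs the cost of dividing by
   ['X - z]. *)
pose e := Num.min eta (rho1 / (2 * c * g)).
have e0 : 0 < e by rewrite lt_min eta0 divr_gt0.
set h := N.+2%:R * b ^+ N.+1.
have h0 : 0 < h by rewrite mulr_gt0 // exprn_gt0.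
have h20 : 0 < 2 * h by rewrite mulr_gt0.
(* The first bound is the other half of the budget; the second makes the polynomial of [ws] smaller
   than [e ^+ N.+1] at [z], so that one of its roots lies within [e] of [z]. *)
pose rho := Num.min (rho1 / (2 * c)) (e ^+ N.+1 / (2 * h)).
have rho0 : 0 < rho by rewrite lt_min !divr_gt0 // exprn_gt0.
exists rho => // -[//|z rs] ws /= [sr] sw rb wb pq.
have zb : cabs z <= b := rb z (mem_head _ _).
have : cabs (rootpoly ws).[z] < e ^+ size ws.
  rewrite sw; have -> : (rootpoly ws).[z] = - (rootpoly (z :: rs) - rootpoly ws).[z].
    by rewrite big_cons !hornerE subrr mul0r sub0r opprK.
  rewrite cabsN.
  apply: le_lt_trans (@cabs_horner_le _ N.+1 rho b _ _ _ _ pq) _ => //.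
    apply: leq_trans (size_polyD _ _) _.
    by rewrite size_polyN !size_rootpoly /= sr sw maxnn.
  have : rho <= e ^+ N.+1 / (2 * h) by rewrite ge_min lexx orbT.
  rewrite ler_pdivlMr // => hle.
  have : 0 < e ^+ N.+1 by rewrite exprn_gt0.
  have -> : N.+2%:R * (rho * b ^+ N.+1) = rho * h by rewrite /h; ring.
  nra.
rewrite cabs_prod => /(prod_cabs_lt (ltW e0))[w ws_w zw].
have pw := perm_to_rem ws_w.
have sw1 : size (rem w ws) = N by rewrite size_rem // sw.
have rb1 v : v \in rs -> cabs v <= b by move=> vs; rewrite rb // inE vs orbT.
have wb1 v : v \in rem w ws -> cabs v <= b by move=> /mem_rem; exact: wb.
have [|ws' pws' ws'P] := IH rs (rem w ws) sr sw1 rb1 wb1.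
  (* The linear factors removed, ['X - z] and ['X - w], differ; subtracting [(w - z)] times the
     reduced polynomial makes [E] exactly divisible by ['X - z]. *)
  move=> i; pose E := rootpoly (z :: rs) - rootpoly ws - (w - z)%:P * rootpoly (rem w ws).
  have EE : E = ('X - z%:P) * (rootpoly rs - rootpoly (rem w ws)).
    rewrite /E (perm_big _ pw) !big_cons polyCB /=; ring.
  have : forall i, cabs E`_i <= rho + e * g.
    move=> j; rewrite coefB coefCM; apply: le_trans (cabsD _ _) _.
    rewrite cabsN lerD // cabsM; apply: ler_pM; rewrite ?cabs_ge0 //.
      by rewrite cabsB ltW.
    by rewrite /g -sw1 coef_rootpoly_le // ltW.
  move=> /(coef_divXsub_le EE) -/(_ N b) H.
  apply: le_trans (H _ _ _ _ i) _ => //; last 2 first.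
  - by rewrite addr_ge0 ?mulr_ge0 // ltW.
  - have r1 : rho <= rho1 / (2 * c) by rewrite ge_min lexx.
    have e1 : e <= rho1 / (2 * c * g) by rewrite ge_min lexx orbT.
    move: r1 e1; rewrite !ler_pdivlMr // => r1 e1.
    have -> : N%:R * ((rho + e * g) * b ^+ N) = (rho + e * g) * (c - 1).
      by rewrite /c; ring.
    have : 0 < e * g by rewrite mulr_gt0.
    nra.
  by rewrite size_rootpolyB // sr.
exists (w :: ws').
  by rewrite (perm_trans pw) // perm_cons.
case=> [_|i] /=; last exact: ws'P.
by rewrite (le_trans (ltW zw)) // ge_min lexx.
Qed.
End RootContinuity.

(** * Following roots along a segment of polynomials *)

Section RootTracking.
Context {R : realType}.
Local Notation C := R[i].
Local Notation rootpoly s := (\prod_(w <- s) ('X - w%:P) : {poly C}).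
Local Notation RC := (real_complex R).

Lemma monic_rootpoly (p : {poly C}) : p \is monic -> exists s, p = rootpoly s.
Proof.
move=> /monicP pm; have [s ps] := closed_field_poly_normal p.
by exists s; rewrite ps pm scale1r.
Qed.

Lemma mup_rootpoly (s : seq C) z : mup z (rootpoly s) = count_mem z s.
Proof.
elim: s => [|w s IHs]; first by rewrite big_nil mupNroot // rootC oner_eq0.
rewrite big_cons mupM ?polyXsubC_eq0 ?monic_neq0 ?monic_prod_XsubC //.
by rewrite IHs -['X - _]expr1 mup_XsubCX /=; case: eqP.
Qed.

Lemma deriv_rootpoly (s : seq C) z : z \notin s ->
  (rootpoly s)^`().[z] = (rootpoly s).[z] * \sum_(w <- s) (z - w)^-1.
Proof.
elim: s => [_|w s IHs]; first by rewrite !big_nil derivC horner0 mulr0.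
rewrite inE negb_or => /andP[zw zs].
rewrite !big_cons derivM derivXsubC !hornerE IHs //.
by set S := \sum_(_ <- _) _; set p := _.[z]; field; rewrite subr_eq0.
Qed.

(** Every point of the segment is monic of degree [N]. With [m] steps, consecutive polynomials
    differ by at most [L / m <= rho] in each coefficient, and [roots_close] then reorders each root
    list to match the one before it. A fixed index [i] thus follows a single root. *)
Lemma linear_homotopy_chain (p0 p1 : {poly C}) (N : nat) (b eta : R) (rs : seq C) :
  0 < eta -> p0 \is monic -> p1 \is monic ->
  size p0 = N.+1 -> size p1 = N.+1 -> p0 = rootpoly rs ->
  (forall (u : R) z, 0 <= u <= 1 ->
     root (RC (1 - u) *: p0 + RC u *: p1) z -> cabs z <= b) ->
  exists m (c : nat -> seq C), [/\ (0 < m)%N, c 0%N = rs,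
    (forall j, (j <= m)%N -> size (c j) = N /\
      RC (1 - j%:R / m%:R) *: p0 + RC (j%:R / m%:R) *: p1 = rootpoly (c j)) &
    (forall j i, (j < m)%N -> (i < N)%N -> cabs ((c j)`_i - (c j.+1)`_i) <= eta)].
Proof.
move=> eta0 m0 m1 s0 s1 p0E Hb.
pose P (u : R) := RC (1 - u) *: p0 + RC u *: p1.
have PN u : (P u)`_N = 1.
  move: m0 m1 => /monicP + /monicP; rewrite /lead_coef s0 s1 /P /= => h0 h1.
  by rewrite coefD !coefZ h0 h1 !mulr1 -rmorphD subrK rmorph1.
have Psize u : size (P u) = N.+1.
  apply/eqP; rewrite eqn_leq; apply/andP; split.
    apply: leq_trans (size_polyD _ _) _.
    by rewrite geq_max !(leq_trans (size_scale_leq _ _)) ?s0 ?s1.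
  rewrite ltnNge; apply/negP => h.
  by have := PN u; rewrite nth_default // => /eqP; rewrite eq_sym oner_eq0.
have Pmonic u : P u \is monic by rewrite monicE /lead_coef Psize /= PN.
pose b1 := Num.max b 1.
have b11 : 1 <= b1 by rewrite le_max lexx orbT.
have [rho rho0 close] := roots_close b11 N eta0.
pose L := \sum_(i < N.+1) cabs (p1 - p0)`_i.
have coefL i : cabs (p1 - p0)`_i <= L.
  case: (ltnP i N.+1) => iN.
    by rewrite /L (bigD1 (Ordinal iN)) //= lerDl sumr_ge0 // => j _; exact: cabs_ge0.
  by rewrite coefB !nth_default ?s0 ?s1 // subrr cabs0 sumr_ge0 // => j _; exact: cabs_ge0.
pose m := (Num.truncn (L / rho)).+1.
have mgt0 : 0 < m%:R :> R by rewrite ltr0n.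
have Lm : L / m%:R <= rho.
  by rewrite ler_pdivrMr // mulrC -ler_pdivrMr // ltW // truncnS_gt.
have step j (s : seq C) : (j < m)%N -> size s = N -> P (j%:R / m%:R) = rootpoly s ->
  exists s', [/\ size s' = N, P (j.+1%:R / m%:R) = rootpoly s' &
     forall i, (i < N)%N -> cabs (s`_i - s'`_i) <= eta].
  move=> jm sN sP; have [s' s'P] := monic_rootpoly (Pmonic (j.+1%:R / m%:R)).
  have s'N : size s' = N by apply/eq_add_S; rewrite -size_rootpoly -s'P Psize.
  have frac i : (i <= m)%N -> 0 <= i%:R / m%:R <= (1 : R).
    by move=> im; rewrite divr_ge0 ?ler0n //= ler_pdivrMr // mul1r ler_nat.
  have bnd i t : (i <= m)%N -> P (i%:R / m%:R) = rootpoly t ->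
      forall z, z \in t -> cabs z <= b1.
    move=> im iP z zt; rewrite le_max (Hb (i%:R / m%:R)) ?frac //.
    by rewrite -/(P _) iP root_prod_XsubC.
  have [|s'' ss'' s''P] := close s s' sN s'N (bnd j s (ltnW jm) sP) (bnd j.+1 s' jm s'P).
    move=> i; rewrite -sP -s'P.
    have -> : P (j%:R / m%:R) - P (j.+1%:R / m%:R) = - (RC (m%:R^-1) *: (p1 - p0)).
      rewrite /P -natr1 mulrDl mul1r; set x := _ / _; set y := _^-1.
      by rewrite !rmorphB !rmorphD /= -!mul_polyC !(polyCB, polyCD); ring.
    rewrite coefN coefZ cabsN cabsM cabs_real ger0_norm ?invr_ge0 //.
    by apply: le_trans Lm; rewrite mulrC ler_wpM2r ?invr_ge0.
  exists s''; split => //; first by rewrite -(perm_size ss'').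
  by rewrite s'P; apply: perm_big.
have [c [c0 cP cS]] : exists c : nat -> seq C, [/\ c 0%N = rs,
    (forall j, (j <= m)%N -> size (c j) = N /\ P (j%:R / m%:R) = rootpoly (c j)) &
    (forall j i, (j < m)%N -> (i < N)%N -> cabs ((c j)`_i - (c j.+1)`_i) <= eta)].
  (* The lists are chosen one after the other, since the order of each depends on its
     predecessor. *)
  suff key k : (k <= m)%N -> exists c : nat -> seq C, [/\ c 0%N = rs,
    (forall j, (j <= k)%N -> size (c j) = N /\ P (j%:R / m%:R) = rootpoly (c j)) &
    (forall j i, (j < k)%N -> (i < N)%N -> cabs ((c j)`_i - (c j.+1)`_i) <= eta)].
    exact: key.
  elim: k => [_|k IHk km].
    exists (fun=> rs); split => // j; rewrite leqn0 => /eqP ->; split.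
      by apply/eq_add_S; rewrite -size_rootpoly -p0E s0.
    by rewrite mul0r /P subr0 rmorph0 rmorph1 scale1r scale0r addr0.
  have [c [c0 cP cS]] := IHk (ltnW km).
  have [sk kP] := cP k (leqnn k).
  have [s' [s'N s'P s'S]] := step k (c k) km sk kP.
  exists (fun j => if (j <= k)%N then c j else s'); split => //.
    by move=> j; rewrite leq_eqVlt ltnS => /predU1P[->|jk]; rewrite ?ltnn ?jk; auto.
  move=> j i; rewrite ltnS leq_eqVlt => /predU1P[->|jk] iN.
    by rewrite /= eqxx ltnn; apply: s'S.
  by rewrite /= jk orbT; apply: cS.
by exists m, c; split.
Qed.

(* If the chain reached distance 4 delta s from xi i, then it would, for each
   q <= s, pass at distance about 4 delta q from xi i, hence near a different point
   xi l for each of the s + 1 values of q. *)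
Lemma chain_stays_close (c : nat -> C) (m s : nat) (xi : nat -> C) (delta : R) i :
  0 < delta -> (i < s)%N -> c 0%N = xi i ->
  (forall j, (j < m)%N -> cabs (c j - c j.+1) <= delta) ->
  (forall j, (j <= m)%N -> exists2 l, (l < s)%N & cabs (c j - xi l) <= delta) ->
  cabs (c m - xi i) < 4 * delta * s%:R.
Proof.
move=> d0 is_ c0 cS cN; rewrite ltNge; apply/negP => far.
have reach (q : 'I_s.+1) : exists l : 'I_s,
    4 * delta * q%:R - delta <= cabs (xi l - xi i) <= 4 * delta * q%:R + 2 * delta.
  (* The first passage beyond distance [4 * delta * q]; minimality and the step size limit the
     overshoot to [delta]. *)
  have ex : exists j, 4 * delta * q%:R <= cabs (c j - xi i).
    exists m; apply: le_trans far; rewrite ler_pM2l ?mulr_gt0 // ler_nat.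
    by rewrite -ltnS.
  case: (ex_minnP ex) => j jfar jmin.
  have jm : (j <= m)%N.
    apply: jmin; apply: le_trans far; rewrite ler_pM2l ?mulr_gt0 // ler_nat.
    by rewrite -ltnS.
  have near_ : cabs (c j - xi i) <= 4 * delta * q%:R + delta.
    case: j jfar jmin jm => [|j] jfar jmin jm.
      by rewrite c0 subrr cabs0 addr_ge0 // ?mulr_ge0 // ltW // mulr_gt0.
    have : cabs (c j - xi i) < 4 * delta * q%:R.
      by rewrite ltNge; apply/negP => /jmin; rewrite ltnn.
    have := cabs_triangle (c j) (c j.+1) (xi i); rewrite (cabsB (c j.+1) (c j)).
    have := cS j jm; lra.
  have [l ls lc] := cN j jm; exists (Ordinal ls) => /=.
  have := cabs_triangle (c j) (xi l) (xi i); rewrite (cabsB (xi l) (c j)).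
  have := cabs_triangle (xi l) (c j) (xi i).
  by move=> h1 h2; apply/andP; split; lra.
have [f fP] := choice reach.
have finj : injective f.
  suff wl (q r : 'I_s.+1) : (q < r)%N -> f q = f r -> False.
    move=> q r qr; apply/val_inj/eqP; case: ltngtP => // h; exfalso.
      exact: wl h qr.
    exact: wl h (esym qr).
  (* The distance bands are disjoint: they have width [3 * delta] and are spaced by [4 * delta]. So
     [s.+1] bands would inject into [s] points. *)
  move=> qr e; have := fP q; have := fP r; rewrite e => /andP[h _] /andP[_ h'].
  have : delta * (q%:R + 1) <= delta * r%:R by rewrite ler_pM2l // natr1 ler_nat.
  set x := (q%:R : R) in h h' *; set y := (r%:R : R) in h h' *; lra.
by have := leq_card f finj; rewrite !card_ord ltnn.
Qed.

(** Up to the factor [|z - w|^2], twice this real part is [|z|^2 - |w|^2 + |z - w|^2]. *)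
Lemma Re_div_gt0 (z w : C) : cabs w < cabs z -> 0 < complex.Re (z * (z - w)^-1).
Proof.
case: z w => [a b] [c d] h.
have {}h : c ^+ 2 + d ^+ 2 < a ^+ 2 + b ^+ 2.
  by move: h; rewrite /cabs /= !ltNge; apply: contra; apply: ler_wsqrtr.
have e0 : 0 < (a - c) ^+ 2 + (b - d) ^+ 2.
  rewrite lt_neqAle addr_ge0 ?sqr_ge0 // andbT eq_sym paddr_eq0 ?sqr_ge0 //.
  rewrite !sqrf_eq0 !subr_eq0; apply: contraTN h => /andP[/eqP-> /eqP->].
  by rewrite ltxx.
rewrite /=; set e := _ + _ in e0 *.
have -> : a * ((a - c) / e) - b * - ((b - d) / e) = (a * (a - c) + b * (b - d)) / e by ring.
rewrite divr_gt0 //.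
have := sqr_ge0 (a - c); have := sqr_ge0 (b - d); move: h; rewrite !expr2; lra.
Qed.

Lemma Re_sum_gt0 (z : C) (s : seq C) (b : R) :
  b < cabs z -> (forall w, w \in s -> cabs w <= b) ->
  0 <= complex.Re (z * \sum_(w <- s) (z - w)^-1) ?= iff (s == [::]).
Proof.
move=> bz; elim: s => [_|w s IHs sb]; first by rewrite big_nil mulr0; split; rewrite ?eqxx.
have w0 := Re_div_gt0 (le_lt_trans (sb w (mem_head _ _)) bz).
have [s0 _] := IHs (fun v vs => sb v (mem_behead (s := w :: s) vs)).
rewrite big_cons mulrDr raddfD /=; split; first by rewrite addr_ge0 // ltW.
by rewrite lt_eqF // ltr_pwDl.
Qed.

End RootTracking.

(** * Critical points near outlying roots: the deterministic argument *)

Section CriticalPoints.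
Context {R : realType}.
Local Notation C := R[i].
Local Notation rootpoly s := (\prod_(w <- s) ('X - w%:P) : {poly C}).
Local Notation RC := (real_complex R).
Local Notation logder s z := (\sum_(w <- s) (z - w)^-1).

Lemma horner_deriv_mix (s t : seq C) (a b : R) z : z \notin s -> z \notin t ->
  (RC a *: ((rootpoly t)^`() * rootpoly s) + RC b *: (rootpoly s * rootpoly t)^`()).[z] =
  (rootpoly s).[z] * (rootpoly t).[z] *
    (RC (a + b) * logder t z + RC b * logder s z).
Proof.
move=> zs zt; rewrite derivM !hornerE !deriv_rootpoly // rmorphD /=; ring.
Qed.

Lemma logder_balance (s t : seq C) (a b : R) z : 0 < a -> 0 <= b <= a ->
  RC a * logder t z + RC b * logder s z = 0 ->
  cabs (logder t z) <= \sum_(w <- s) (cabs (z - w))^-1.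
Proof.
move=> a0 /andP[b0 ba] /eqP; rewrite addr_eq0 => /eqP /(congr1 (@cabs R)).
rewrite cabsN !cabsM !cabs_real !ger0_norm ?(ltW a0) // => e.
have : a * cabs (logder t z) <= a * cabs (logder s z).
  by rewrite e ler_wpM2r ?cabs_ge0.
rewrite ler_pM2l // => /le_trans; apply.
apply: le_trans (cabs_sum _ _ _) _; apply: ler_sum => w _.
by rewrite cabsV.
Qed.

(** The Gauss-Lucas argument for a disc centred at 0: beyond radius [B], multiplication by [z] puts
    the logarithmic derivative of [t] in the open right half-plane and that of [s] in the closed
    one, so the weighted sum cannot vanish. *)
Lemma deriv_mix_roots_bounded (s t : seq C) (a b B : R) z :
  0 < a + b -> 0 <= b -> t != [::] ->
  (forall w, w \in s ++ t -> cabs w <= B) ->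
  root (RC a *: ((rootpoly t)^`() * rootpoly s) + RC b *: (rootpoly s * rootpoly t)^`()) z ->
  cabs z <= B.
Proof.
move=> a0 b0 t0 stB; rewrite leNgt => h; apply/negP => Bz.
have sB w : w \in s -> cabs w <= B by move=> ws; rewrite stB // mem_cat ws.
have tB w : w \in t -> cabs w <= B by move=> wt; rewrite stB // mem_cat wt orbT.
have zs : z \notin s by apply: contraL Bz => /sB; rewrite leNgt.
have zt : z \notin t by apply: contraL Bz => /tB; rewrite leNgt.
move: h; rewrite rootE horner_deriv_mix // !mulf_eq0.
rewrite -!rootE !root_prod_XsubC (negbTE zs) (negbTE zt) /= => /eqP/(congr1 (fun x => complex.Re (z * x))).
have [sge _] := Re_sum_gt0 Bz sB; have [tge te] := Re_sum_gt0 Bz tB.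
have tgt : 0 < complex.Re (z * logder t z) by rewrite lt_neqAle te t0 tge.
rewrite mulr0 mulrDr !(mulrCA z (RC _)) raddfD /=.
move: (z * logder t z) (z * logder s z) sge tgt => [x x'] [y y'] /=.
rewrite !mul0r !subr0; nra.
Qed.

Lemma deriv_rootpoly_monic (s : seq C) n : size s = n.+1 ->
  n.+1%:R^-1 *: (rootpoly s)^`() \is monic /\
  size (n.+1%:R^-1 *: (rootpoly s)^`()) = n.+1.
Proof.
move=> sn; have := monicP (monic_prod_XsubC s xpredT (fun w : C => w)).
rewrite /lead_coef size_rootpoly sn /= => lc.
have n0 : n.+1%:R != 0 :> C by rewrite pnatr_eq0.
have cn : (n.+1%:R^-1 *: (rootpoly s)^`())`_n = 1.
  by rewrite coefZ coef_deriv lc mulVf.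
have sz : size (n.+1%:R^-1 *: (rootpoly s)^`()) = n.+1.
  apply/eqP; rewrite eqn_leq; apply/andP; split.
    rewrite (leq_trans (size_scale_leq _ _)) // -sn -ltnS -size_rootpoly.
    by rewrite lt_size_deriv // -size_poly_eq0 size_rootpoly.
  rewrite ltnNge; apply/negP => h.
  by move/eqP: cn; rewrite nth_default // eq_sym oner_eq0.
by split => //; rewrite monicE /lead_coef sz /= cn.
Qed.

(** Here [s] holds the outlying roots, [t] all others, and [out] abstracts the complement of the
    neighbourhood. A root of the homotopy in [out] must be within [delta] of some point of [s],
    where there is still room inside [out]; hence no tracked root can cross the boundary in either
    direction. *)
Lemma critical_points_track (s t : seq C) (B c0 delta : R) (out : C -> Prop) :
  0 < delta -> t != [::] -> (forall w, w \in s ++ t -> cabs w <= B) ->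
  (size s)%:R < c0 * delta ->
  (forall z, out z -> cabs z <= B -> c0 <= cabs (logder t z)) ->
  (forall w, w \in t -> ~ out w) ->
  (forall l z, (l < size s)%N ->
     cabs (z - s`_l) <= 4 * delta * (size s)%:R + delta -> out z) ->
  exists ws, [/\ size ws = size s, (forall w, w \in ws -> out w),
    (rootpoly (s ++ t))^`() != 0,
    (forall z, out z -> mup z (rootpoly (s ++ t))^`() = count_mem z ws) &
    (forall l, (l < size s)%N ->
       cabs (ws`_l - s`_l) <= 4 * delta * (size s)%:R)].
Proof.
move=> d0 t0 stB sc0 out_big t_in out_near.
have [q tq] : exists q, size t = q.+1 by case: (t) t0 => // ? l _; exists (size l).
set k := size s in sc0 out_near *.
have stn : size (s ++ t) = (k + q).+1 by rewrite size_cat tq addnS.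
have [m1 s1] := deriv_rootpoly_monic stn; have [mt st] := deriv_rootpoly_monic tq.
set p1 := _ *: _ in m1 s1.
have [rs rsP] := monic_rootpoly mt.
have rsq : size rs = q by apply/eq_add_S; rewrite -size_rootpoly -rsP.
pose p0 : {poly C} := rootpoly (s ++ rs).
have m0 : p0 \is monic by exact: monic_prod_XsubC.
have s0 : size p0 = (k + q).+1 by rewrite size_rootpoly size_cat rsq.
(* The weights of the unnormalised polynomials once the leading coefficients [q.+1] and [(k + q).+1]
   of the derivatives are divided out. *)
pose al (u : R) := (1 - u) / q.+1%:R; pose be (u : R) := u / (k + q).+1%:R.
have mixE (u : R) : RC (1 - u) *: p0 + RC u *: p1 =
    RC (al u) *: ((rootpoly t)^`() * rootpoly s) +
    RC (be u) *: (rootpoly s * rootpoly t)^`().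
  rewrite /al /be /p0 /p1 !big_cat /= -rsP !rmorphM /= !fmorphV !rmorph_nat.
  by rewrite -!scalerA -scalerAr [rootpoly s * _^`()]mulrC.
have ab (u : R) : 0 <= u <= 1 -> 0 <= al u /\ 0 <= be u /\ 0 < al u + be u.
  move=> /andP[u0 u1]; rewrite /al /be.
  have q1 : 0 < q.+1%:R^-1 :> R by rewrite invr_gt0.
  have q2 : 0 < (k + q).+1%:R^-1 :> R by rewrite invr_gt0.
  have [q3 q4] := (ltW q1, ltW q2).
  split; [|split]; [by rewrite mulr_ge0 ?subr_ge0|by rewrite mulr_ge0|].
  case: (ltP u 1) => h.
    by rewrite ltr_pwDl ?mulr_gt0 ?subr_gt0 // mulr_ge0 // ltW.
  have -> : u = 1 by apply/le_anti; rewrite u1 h.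
  by rewrite subrr mul0r add0r mul1r.
have bounded (u : R) z : 0 <= u <= 1 ->
    root (RC (1 - u) *: p0 + RC u *: p1) z -> cabs z <= B.
  move=> u01; rewrite mixE; have [_ [b0 ab0]] := ab u u01.
  exact: deriv_mix_roots_bounded ab0 b0 t0 stB.
have near_s (u : R) z : 0 <= u <= 1 -> root (RC (1 - u) *: p0 + RC u *: p1) z ->
    out z -> exists2 l, (l < k)%N & cabs (z - s`_l) <= delta.
  move=> u01 rz oz; have [a0 [b0 ab0]] := ab u u01.
  have zt : z \notin t by apply/negP => /t_in.
  case: (boolP (z \in s)) => zs.
    by exists (index z s); rewrite ?index_mem // nth_index // subrr cabs0 ltW.
  have zB := bounded u z u01 rz.
  move: rz; rewrite mixE rootE horner_deriv_mix // !mulf_eq0.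
  rewrite -!rootE !root_prod_XsubC (negbTE zs) (negbTE zt) /= => /eqP h.
  have ba : 0 <= be u <= al u + be u by rewrite b0 lerDr.
  have := le_trans (out_big z oz zB) (logder_balance ab0 ba h).
  move=> c0le; case: (pselect (exists2 l, (l < k)%N & cabs (z - s`_l) <= delta)) => // far.
  (* Away from all of [s] the balance equation would give [c0 <= k / delta], against the choice of
     [delta]. *)
  have : \sum_(w <- s) (cabs (z - w))^-1 <= k%:R / delta.
    rewrite mulr_natl (big_nth 0) big_mkord -[k]card_ord -sumr_const.
    apply: ler_sum => l _; rewrite lef_pV2 ?posrE ?cabs_gt0 //.
      by rewrite leNgt; apply/negP => /ltW hl; apply: far; exists l.
    by rewrite subr_eq0; apply: contraNneq zs => ->; rewrite mem_nth.
  move=> /(le_trans c0le); rewrite ler_pdivlMr //; move: sc0; lra.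
have [m [c [m_gt0 cz cP cS]]] :=
  linear_homotopy_chain d0 m0 m1 s0 s1 erefl bounded.
have frac i : (i <= m)%N -> 0 <= i%:R / m%:R <= (1 : R).
  move=> im; rewrite divr_ge0 ?ler0n //= ler_pdivrMr ?ltr0n //.
  by rewrite mul1r ler_nat.
have rootc i j : (i < k + q)%N -> (j <= m)%N ->
    root (RC (1 - j%:R / m%:R) *: p0 + RC (j%:R / m%:R) *: p1) (c j)`_i.
  move=> ik jm; have [cj ->] := cP j jm.
  by rewrite root_prod_XsubC mem_nth // cj.
have near_c i j : (i < k + q)%N -> (j <= m)%N -> out (c j)`_i ->
    exists2 l, (l < k)%N & cabs ((c j)`_i - s`_l) <= delta.
  by move=> ik jm; apply: near_s (rootc i j ik jm); exact: frac.
(* At the start, a zero of the derivative in [out] would make the logarithmic derivative of [t]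
   vanish there. Later, a root entering [out] lands within [delta] of some point of [s], so one step
   earlier it was within [2 * delta] of that point and already in [out]. *)
have inner i j : (k <= i < k + q)%N -> (j <= m)%N -> ~ out (c j)`_i.
  move=> /andP[ki ikq]; elim: j => [_|j IHj jm].
    rewrite cz nth_cat ltnNge ki /= => oz.
    have rz : root (rootpoly t)^`() rs`_(i - k).
      have : root (rootpoly rs) rs`_(i - k).
        by rewrite root_prod_XsubC mem_nth // rsq; lia.
      by rewrite -rsP rootZ // invr_eq0 pnatr_eq0.
    have zt : rs`_(i - k) \notin t by apply/negP => /t_in; apply.
    move: rz; rewrite rootE deriv_rootpoly // mulf_eq0 -rootE root_prod_XsubC.
    rewrite (negbTE zt) /= => /eqP g0.
    have zB : cabs rs`_(i - k) <= B.
      apply: (bounded 0); rewrite ?lexx ?ler01 // subr0 rmorph1 scale1r rmorph0.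
      by rewrite scale0r addr0 root_prod_XsubC mem_cat mem_nth ?orbT // rsq; lia.
    have := out_big _ oz zB; rewrite g0 cabs0.
    by have : 0 <= k%:R :> R by []; move: sc0; nra.
  move=> oz; have [l lk hl] := near_c i j.+1 ikq jm oz.
  apply: (IHj (ltnW jm)); apply: (out_near l) => //.
  have := cabs_triangle (c j.+1)`_i (c j)`_i s`_l; have := cS j i jm ikq.
  have : delta * 1 <= delta * k%:R.
    by rewrite ler_pM2l // ler1n (leq_trans _ lk).
  lra.
(* The two claims feed each other: remaining in [out] so far gives closeness to the starting point,
   and closeness gives [out] for the next step. *)
have outer i : (i < k)%N -> forall j, (j <= m)%N ->
    (forall j', (j' <= j)%N -> out (c j')`_i) /\
    cabs ((c j)`_i - s`_i) < 4 * delta * k%:R.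
  move=> ik; have ikq : (i < k + q)%N by rewrite ltn_addr.
  have ci0 : (c 0%N)`_i = s`_i by rewrite cz nth_cat ik.
  have close j : (j <= m)%N -> (forall j', (j' <= j)%N -> out (c j')`_i) ->
      cabs ((c j)`_i - s`_i) < 4 * delta * k%:R.
    move=> jm oj.
    apply: (@chain_stays_close _ (fun j => (c j)`_i) j k (fun l => s`_l)) => //.
      by move=> j' h; apply: cS => //; exact: leq_trans jm.
    by move=> j' h; apply: near_c => //; [exact: leq_trans jm|exact: oj].
  elim=> [_|j IHj jm].
    have o0 j' : (j' <= 0)%N -> out (c j')`_i.
      rewrite leqn0 => /eqP->; apply: (out_near i) => //.
      by rewrite ci0 subrr cabs0 addr_ge0 ?mulr_ge0 // ltW.
    by split => //; exact: close.
  have [oj dj] := IHj (ltnW jm).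
  have o1 j' : (j' <= j.+1)%N -> out (c j')`_i.
    rewrite leq_eqVlt ltnS => /predU1P[->|/oj//]; apply: (out_near i) => //.
    have := cabs_triangle (c j)`_i (c j.+1)`_i s`_i; have := cS j i jm ikq.
    rewrite (cabsB (c j)`_i (c j.+1)`_i); move: dj; lra.
  by split => //; exact: close.
have [cm p1E] := cP m (leqnn m).
have p1c : p1 = rootpoly (c m).
  by rewrite -p1E divff ?pnatr_eq0 -?lt0n // subrr rmorph0 rmorph1 scale0r scale1r add0r.
have derE : (rootpoly (s ++ t))^`() = (k + q).+1%:R *: rootpoly (c m).
  by rewrite -p1c /p1 scalerA divff ?pnatr_eq0 // scale1r.
have sk : size (take k (c m)) = k by rewrite size_takel // cm leq_addr.
exists (take k (c m)); split => //.
- move=> w wt; have ik : (index w (take k (c m)) < k)%N by rewrite -{2}sk index_mem.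
  rewrite -(nth_index 0 wt) nth_take //.
  by have [h _] := outer _ ik m (leqnn m); exact: h.
- by rewrite derE scaler_eq0 pnatr_eq0 /= monic_neq0 // monic_prod_XsubC.
- move=> z oz; rewrite derE -mul_polyC mupMr; last by rewrite rootC pnatr_eq0.
  rewrite mup_rootpoly -{1}(cat_take_drop k (c m)) count_cat.
  rewrite [X in (_ + X)%N](_ : _ = 0%N) ?addn0 //; apply/count_memPn.
  apply/negP => zd; set i := index z (drop k (c m)).
  have ik : (i < q)%N by rewrite -(addKn k q) -cm -size_drop index_mem.
  apply: (inner (k + i)%N m) => //; first by rewrite leq_addr ltn_add2l.
  by rewrite -nth_drop nth_index.
- move=> l lk; rewrite nth_take //.
  by have [_ /ltW] := outer l lk m (leqnn m).
Qed.
End CriticalPoints.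

(** * The law of large numbers for events *)
Section BernoulliLLN.
Context {R : realType}.

Lemma squares_bracket n : exists2 m, (m ^ 2 <= n)%N & (n < m.+1 ^ 2)%N.
Proof.
have bnd m : (m ^ 2 <= n)%N -> (m <= n)%N by move=> h; nia.
have ex : exists m, (m ^ 2 <= n)%N by exists 0%N.
case: (ex_maxnP ex bnd) => m mn mmax; exists m => //.
by rewrite ltnNge; apply/negP => /mmax; rewrite ltnn.
Qed.

(** Between [m ^ 2] and the next square there are at most [2 * m] further terms, each at most 1 in
    modulus, which is negligible against [m ^ 2]. *)
Lemma average_along_squares (x : nat -> R) : (forall i, `|x i| <= 1) ->
  (forall e, 0 < e -> exists M, forall m, (M <= m)%N ->
     `|\sum_(i < m ^ 2) x i| <= e * (m ^ 2)%:R) ->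
  forall e, 0 < e -> exists N, forall n, (N <= n)%N -> `|\sum_(i < n) x i| <= e * n%:R.
Proof.
move=> x1 sq e e0; have [M MP] := sq (e / 2) (divr_gt0 e0 (ltr0n _ 2)).
pose M' := maxn M (Num.truncn (4 / e)).+1.
exists (M' ^ 2)%N => n Mn; have [m mn nm] := squares_bracket n.
have Mm : (M' <= m)%N by rewrite -ltnS -(ltn_exp2r _ _ (erefl (0 < 2)%N)); exact: leq_ltn_trans nm.
have h1 := MP m (leq_trans (leq_maxl _ _) Mm).
have h2 : 2 <= e / 2 * m%:R.
  have : 4 / e <= m%:R.
    apply: ltW; apply: lt_le_trans (truncnS_gt _) _.
    by rewrite ler_nat (leq_trans (leq_maxr _ _) Mm).
  by rewrite ler_pdivrMr //; lra.
have -> : \sum_(i < n) x i = \sum_(i < m ^ 2) x i + \sum_(m ^ 2 <= i < n) x i.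
  by rewrite -!(big_mkord xpredT) -big_cat_nat.
have h3 : `|\sum_(m ^ 2 <= i < n) x i| <= 2 * m%:R.
  apply: le_trans (ler_norm_sum _ _ _) _.
  apply: (@le_trans _ _ (\sum_(m ^ 2 <= i < n) 1)); first exact: ler_sum.
  rewrite sumr_const_nat -natrM ler_nat; lia.
apply: le_trans (ler_normD _ _) _.
have h4 : (m ^ 2)%:R <= n%:R :> R by rewrite ler_nat.
have h5 : 2 * m%:R <= e / 2 * (m ^ 2)%:R.
  by rewrite -mulnn natrM mulrA ler_wpM2r.
have : e * (m ^ 2)%:R <= e * n%:R by rewrite ler_pM2l.
lra.
Qed.

(** The induction carries the sharper bound [2 - 1 / M.+1], which telescopes. *)
Lemma sum_inv_squares_lt (M : nat) : \sum_(m < M) (m.+1 ^ 2)%:R^-1 <= 2 :> R.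
Proof.
suff : \sum_(m < M.+1) (m.+1 ^ 2)%:R^-1 <= 2 - M.+1%:R^-1 :> R.
  rewrite big_ord_recr /= => h; apply: le_trans (le_trans _ h) _.
    by rewrite lerDl invr_ge0.
  by rewrite gerBl invr_ge0.
elim: M => [|M IHM]; first by rewrite big_ord1 exp1n invr1; lra.
rewrite big_ord_recr /=; apply: le_trans (lerD IHM (lexx _)) _.
rewrite natrX; set a : R := M.+1%:R.
have -> : M.+2%:R = a + 1 :> R by rewrite /a natr1.
have a0 : 0 < a by rewrite ltr0n.
have : (a + 1) ^- 2 <= a^-1 - (a + 1)^-1.
  have -> : a^-1 - (a + 1)^-1 = (a * (a + 1))^-1 by field; rewrite !gt_eqF //; lra.
  by rewrite lef_pV2 ?posrE ?exprn_gt0 ?mulr_gt0 //; nra.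
by move: (a^-1) ((a + 1)^-1) ((a + 1) ^- 2) => u v t; lra.
Qed.

Section Average.
Context {d} {T : measurableType d} (P : probability T R).
Implicit Types (f g : T -> R).

Lemma bounded_integrable f (M : R) : measurable_fun setT f ->
  (forall w, `|f w| <= M) -> P.-integrable setT (EFin \o f).
Proof.
move=> mf fM; apply: measurable_bounded_integrable => //.
  by apply: le_lt_trans (probability_le1 P measurableT) _; exact: ltry.
exists M; split; first by rewrite num_real.
by move=> M' MM' w _; apply: le_trans (fM w) _; exact: ltW.
Qed.

Lemma Rintegral_sum (I : Type) (r : seq I) (f : I -> T -> R) :
  (forall i, P.-integrable setT (EFin \o f i)) ->
  \int[P]_w (\sum_(i <- r) f i w) = \sum_(i <- r) \int[P]_w f i w.
Proof.
move=> fi; elim: r => [|i r IHr].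
  under eq_Rintegral do rewrite big_nil.
  by rewrite big_nil Rintegral_cst // mul0r.
under eq_Rintegral do rewrite big_cons.
rewrite big_cons -IHr RintegralD //.
have -> : (EFin \o (fun w => \sum_(j <- r) f j w)) =
    (fun w => \sum_(j <- r) (EFin \o f j) w)%E.
  by apply/funext => w /=; rewrite sumEFin.
exact: integrable_sum.
Qed.

Variables (E : nat -> set T) (p : R).
Hypothesis mE : forall i, measurable (E i).
Hypothesis PE : forall i, P (E i) = p%:E.
Hypothesis indepE : forall i j, i != j -> P (E i `&` E j) = (p * p)%:E.

Let x i w : R := \1_(E i) w - p.

Let p01 : 0 <= p <= 1.
Proof.
by rewrite -!lee_fin -(PE 0) measure_ge0 /= probability_le1.
Qed.

Let x1 i w : `|x i w| <= 1.
Proof.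
rewrite /x indicE; have := p01; case: (_ \in _) => /= /andP[h1 h2];
  rewrite ler_norml; apply/andP; split; lra.
Qed.

Let mx i : measurable_fun setT (x i).
Proof. by apply: measurable_funB => //; exact: measurable_indic. Qed.

Let int_xx i j : P.-integrable setT (EFin \o (fun w => x i w * x j w)).
Proof.
apply: (@bounded_integrable _ 1); first exact: measurable_funM.
by move=> w; rewrite normrM mulr_ile1.
Qed.

Let Rint_indic (A : set T) : measurable A -> \int[P]_w (\1_A w : R) = fine (P A).
Proof. by move=> mA; rewrite /Rintegral integral_indic // setIT. Qed.

Let Exx i j : \int[P]_w (x i w * x j w) = if i == j then p * (1 - p) else 0.
Proof.
have ii (A : set T) : measurable A -> P.-integrable setT (EFin \o (\1_A : T -> R)).
  move=> mA; apply: (@bounded_integrable _ 1); first exact: measurable_indic.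
  by move=> w; rewrite indicE; case: (_ \in _); rewrite ?normr1 ?normr0.
have ic (c : R) : P.-integrable setT (EFin \o (fun _ : T => c)).
  by apply: (@bounded_integrable _ `|c|) => //.
have -> : (fun w => x i w * x j w) = (fun w =>
    \1_(E i `&` E j) w + ((- p) * \1_(E i) w + ((- p) * \1_(E j) w + p * p))).
  by apply/funext => w; rewrite /x indicI /=; ring.
have iz (c : R) A : measurable A -> P.-integrable setT (EFin \o (fun w => c * \1_A w)).
  move=> mA; have := integrableZl measurableT c (ii A mA).
  by apply: eq_integrable.
have iD f g : P.-integrable setT (EFin \o f) -> P.-integrable setT (EFin \o g) ->
   P.-integrable setT (EFin \o (fun w => f w + g w)).
  by move=> fi gi; have := integrableD measurableT fi gi; apply: eq_integrable.
have j0 := iD _ _ (iz (- p) _ (mE j)) (ic (p * p)).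
have ij0 := iD _ _ (iz (- p) _ (mE i)) j0.
rewrite (RintegralD _ (ii _ (measurableI _ _ (mE i) (mE j))) ij0) //.
rewrite (RintegralD _ (iz _ _ (mE i)) j0) // (RintegralD _ (iz _ _ (mE j)) (ic _)) //.
rewrite !RintegralZl ?Rintegral_cst ?Rint_indic ?PE //; try exact: ii; try exact: measurableI.
rewrite (_ : fine (P setT) = 1) /=; last by rewrite probability_setT.
case: eqP => [->|/eqP ij].
  by rewrite setIid (_ : fine (P (E j)) = p) ?PE //; ring.
by rewrite (_ : fine (P (E i `&` E j)) = p * p) ?indepE //; ring.
Qed.

(** Pairwise independence makes the centred indicators orthogonal, so only [n] diagonal terms
    [p * (1 - p) <= 1] survive. *)
Let second_moment n : \int[P]_w ((\sum_(i < n) x i w) ^+ 2) <= n%:R.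
Proof.
have -> : (fun w => (\sum_(i < n) x i w) ^+ 2) =
    (fun w => \sum_(i < n) \sum_(j < n) (x i w * x j w)).
  by apply/funext => w; rewrite expr2 big_distrlr.
rewrite Rintegral_sum; last first.
  move=> i; have := @integrable_sum _ _ _ P setT measurableT 'I_n (index_enum _)
    xpredT (fun j w => (x i w * x j w)%:E) (fun j _ => int_xx i j).
  by apply: eq_integrable => // w _ /=; rewrite sumEFin.
rewrite -[n in leRHS]card_ord -sumr_const; apply: ler_sum => i _.
rewrite (Rintegral_sum _ (fun j : 'I_n => int_xx i j)).
rewrite (bigD1 i) //= Exx eqxx big1 => [|j ji].
  by rewrite addr0; have /andP[] := p01; nra.
by rewrite Exx eq_sym (negbTE (ji : (j : nat) != i)).
Qed.

(** Along squares the normalised second moments are summable, so the series of the [f m] is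
    integrable and almost surely finite. Its terms then tend to 0, which gives the averages along
    squares for every [e] on one event. *)
Lemma bernoulli_lln : {ae P, forall w, forall e, 0 < e -> exists N, forall n,
  (N <= n)%N -> `|\sum_(i < n) (\1_(E i) w - p)| <= e * n%:R}.
Proof.
pose f m w : \bar R := ((\sum_(i < m.+1 ^ 2) x i w) ^+ 2 / (m.+1 ^ 4)%:R)%:E.
have f0 m w : (0 <= f m w)%E by rewrite lee_fin divr_ge0 // sqr_ge0.
have mS n : measurable_fun setT (fun w => (\sum_(i < n) x i w) ^+ 2).
  by apply: measurable_funX; exact: measurable_sum.
have mf m : measurable_fun setT (f m).
  by apply/measurable_EFinP; apply: measurable_funM => //; exact: mS.
have intf m : (\int[P]_w f m w <= ((m.+1 ^ 2)%:R^-1)%:E)%E.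
  have iS : P.-integrable setT (EFin \o (fun w => (\sum_(i < m.+1 ^ 2) x i w) ^+ 2)).
    apply: (@bounded_integrable _ ((m.+1 ^ 2)%:R ^+ 2)) => //.
    move=> w; rewrite normrX lerXn2r ?nnegrE //.
    apply: le_trans (ler_norm_sum _ _ _) _.
    by rewrite -[(_ ^ _)%N in leRHS]card_ord -sumr_const; apply: ler_sum.
  under eq_integral do rewrite /f mulrC EFinM.
  rewrite integralZl //.
  have -> : (\int[P]_w ((\sum_(i < m.+1 ^ 2) x i w) ^+ 2)%:E)%E =
     (\int[P]_w ((\sum_(i < m.+1 ^ 2) x i w) ^+ 2))%:E.
    by rewrite /Rintegral fineK //; exact: integrable_fin_num.
  rewrite -EFinM lee_fin.
  apply: (@le_trans _ _ ((m.+1 ^ 4)%:R^-1 * (m.+1 ^ 2)%:R)).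
    by rewrite ler_wpM2l ?invr_ge0 ?second_moment.
  have : m.+1%:R != 0 :> R by rewrite pnatr_eq0.
  rewrite !natrX; move: (m.+1%:R : R) => a a0.
  by rewrite le_eqVlt; apply/orP; left; apply/eqP; field.
have : P.-integrable setT (fun w => \sum_(0 <= m <oo) f m w)%E.
  apply/integrableP; split.
    by apply: ge0_emeasurable_sum => // m w _ _; exact: f0.
  under eq_integral do rewrite gee0_abs ?nneseries_ge0 //.
  rewrite integral_nneseries //.
  apply: (@le_lt_trans _ _ 2%:E); last exact: ltry.
  apply: lime_le; first by apply: is_cvg_nneseries => m _ _; exact: integral_ge0.
  apply: nearW => M; rewrite big_mkord.
  apply: le_trans; first by apply: lee_sum => m _; exact: intf.
  by rewrite sumEFin lee_fin sum_inv_squares_lt.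
move=> /(integrable_ae measurableT); apply: filterS => w /(_ I) fin.
apply: (@average_along_squares (x^~ w)) => [i|e e0]; first exact: x1.
have : (\sum_(N <= k <oo) f k w)%E @[N --> \oo] --> 0%E.
  by apply: nneseries_tail_cvg => //; rewrite ltey_eq fin.
have e20 : 0 < e ^+ 2 by rewrite exprn_gt0.
move=> /fine_cvgP[finN /cvgrPdist_lt/(_ _ e20)] [M _ MP]; have [M2 _ M2P] := finN.
(* The shift matches [f m], which concerns the square of [m.+1]; the term [f m] is bounded by the
   tail of the series from [m] on. *)
exists (maxn M M2).+1 => -[//|m]; rewrite ltnS geq_max => /andP[Mm M2m].
have := MP m Mm; rewrite /= sub0r normrN => h.
have : (f m w <= (e ^+ 2)%:E)%E.
  apply: (@le_trans _ _ (\sum_(m <= k <oo) f k w)%E).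
    rewrite (nneseries_split _ 1%N) // addn1 big_nat1 leeDl //.
    by apply: nneseries_ge0.
  rewrite -(fineK (M2P m M2m)) lee_fin.
  exact: le_trans (ler_norm _) (ltW h).
rewrite lee_fin ler_pdivrMr ?ltr0n ?expn_gt0 //.
have -> : e ^+ 2 * (m.+1 ^ 4)%:R = (e * (m.+1 ^ 2)%:R) ^+ 2.
  by rewrite !natrX; ring.
rewrite -real_normK ?num_real // ler_pXn2r // ?nnegrE //.
by rewrite mulr_ge0 // ltW.
Qed.
End Average.
End BernoulliLLN.

(** * The support of a measure on the plane *)
Section Support.
Context {R : realType}.
Implicit Types (U : set (R * R)) (x : R * R).

(** A countable base of the plane made of measurable sets: it links the topology to the product
    sigma-algebra. *)
Definition ratbox (q : (rat * rat) * (rat * rat)) : set (R * R) :=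
  (`]ratr q.1.1, ratr q.1.2[ `*` `]ratr q.2.1, ratr q.2.2[)%classic.

Lemma measurable_ratbox q : measurable (ratbox q).
Proof. by apply: measurableX; exact: measurable_itv. Qed.

(** Numbers that code no box are sent to an empty one. *)
Definition nthbox (n : nat) := ratbox (odflt ((0, 0), (0, 0)) (unpickle n)).

Lemma nthbox_pickle q : nthbox (pickle q) = ratbox q.
Proof. by rewrite /nthbox pickleK. Qed.

Lemma ratbox_basis U x : open U -> U x -> exists q, ratbox q x /\ ratbox q `<=` U.
Proof.
move=> oU Ux; have /nbhs_ballP[e /= e0 eU] : nbhs x U by exact: open_nbhs_nbhs.
have side (y : R) : exists q : rat * rat, ratr q.1 < y < ratr q.2 /\
    forall y' : R, ratr q.1 < y' < ratr q.2 -> `|y - y'| < e.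
  have [a] : exists q : rat, ratr q \in `]y - e / 2, y[ by apply: rat_in_itvoo; lra.
  have [b] : exists q : rat, ratr q \in `]y, y + e / 2[ by apply: rat_in_itvoo; lra.
  rewrite !in_itv /= => /andP[b1 b2] /andP[a1 a2].
  exists (a, b) => /=; split => [|y' /andP[h1 h2]]; first by rewrite a2 b1.
  by rewrite ltr_norml; apply/andP; split; lra.
have [q1 [q1x q1b]] := side x.1; have [q2 [q2x q2b]] := side x.2.
exists (q1, q2); split; first by split => /=; rewrite in_itv.
by move=> y [/= y1 y2]; apply: eU; split; [apply: q1b|apply: q2b]; [move: y1|move: y2]; rewrite in_itv.
Qed.

Lemma open_bigcup_ratbox U : open U ->
  U = \bigcup_(n in [set n | nthbox n `<=` U]) nthbox n.
Proof.
move=> oU; apply/seteqP; split => [x Ux|x [n /= nU]]; last exact: nU.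
have [q [qx qU]] := ratbox_basis oU Ux.
by exists (pickle q); [rewrite -nthbox_pickle in qU|rewrite nthbox_pickle].
Qed.

Lemma open_measurable2 U : open U -> measurable U.
Proof.
move=> oU; rewrite (open_bigcup_ratbox oU).
by apply: bigcup_measurable => n _; exact: measurable_ratbox.
Qed.

Variable mu : probability (R * R)%type R.

Lemma open_setC_supp : open (~` supp mu).
Proof.
rewrite openE => x /= /existsNP[U /not_implyP[oU /not_implyP[Ux muU]]].
apply: (@filterS _ _ _ U); last exact: open_nbhs_nbhs.
by move=> y Uy /(_ U oU Uy).
Qed.

Lemma measurable_supp : measurable (supp mu).
Proof.
rewrite -(setCK (supp mu)).
by apply: measurableC; apply: open_measurable2; exact: open_setC_supp.
Qed.

(** A point outside the support has a null open neighbourhood, hence lies in a null rational box,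
    and there are only countably many of these. *)
Lemma negligible_setC_supp : mu.-negligible (~` supp mu).
Proof.
pose F n := if `[< mu (nthbox n) = 0 >] then nthbox n else set0.
apply: (@negligibleS _ _ _ _ (\bigcup_n F n)).
  move=> x /= /existsNP[U /not_implyP[oU /not_implyP[Ux muU]]].
  have [q [qx qU]] := ratbox_basis oU Ux.
  exists (pickle q); first exact: I.
  rewrite /F nthbox_pickle; case: asboolP => // q0.
  exfalso; apply: muU; apply: (@lt_le_trans _ _ (mu (ratbox q))).
    by rewrite lt_neqAle measure_ge0 andbT eq_sym; apply/eqP.
  by apply: le_measure => //; rewrite inE; [exact: measurable_ratbox|exact: open_measurable2].
apply: negligible_bigcup => n; rewrite /F; case: asboolP => h; last exact: negligible_set0.
by exists (nthbox n); split => //; exact: measurable_ratbox.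
Qed.

Lemma supp_ae : {ae mu, forall x, supp mu x}.
Proof. exact: negligible_setC_supp. Qed.

Lemma probability_supp : mu (supp mu) = 1%E.
Proof.
have mC : measurable (~` supp mu) by apply: measurableC; exact: measurable_supp.
have := probability_setC mu mC.
rewrite setCK => ->; have : mu (~` supp mu) = 0%E.
  by apply/measure_negligible; [apply: measurableC; exact: measurable_supp|exact: negligible_setC_supp].
by move=> ->; rewrite sube0.
Qed.

Lemma supp_nonempty : exists x, supp mu x.
Proof.
apply: contrapT => /forallNP h; have := probability_supp.
rewrite (_ : supp mu = set0) ?measure0; last by apply/seteqP; split.
by move=> /eqP; rewrite eq_sym onee_eq0.
Qed.

(** Balls of the product space are squares, so each coordinate contributes up to [e]. *)
Lemma cabs_toCB_lt x y (e : R) : ball x e y -> cabs (toC x - toC y) < 2 * e.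
Proof.
move=> [/= h1 h2]; apply: le_lt_trans (cabs_le _) _ => /=.
by move: h1 h2; rewrite /ball /= => h1 h2; lra.
Qed.

Lemma compact_cover_plane (A : set (R * R)) : compact A -> cover_compact A.
Proof.
pose T : ptopologicalType := HB.pack (R * R)%type.
by have /(congr1 (fun c => c A)) -> := compact_cover T.
Qed.

(* The cells are the points of the support whose first ball, in a finite cover by
   balls listed in order, is the k-th one. *)
Lemma supp_partition (h : R) : compact (supp mu) -> 0 < h ->
  exists (m : nat) (E : nat -> set (R * R)) (e : nat -> R * R),
    [/\ (forall k, measurable (E k)),
        (forall k, (k < m)%N -> supp mu (e k)) &
        (forall x, supp mu x -> exists k0, [/\ (k0 < m)%N,
           (forall k, E k x <-> k = k0) & cabs (toC (e k0) - toC x) <= h])].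
Proof.
move=> cS h0.
have := compact_cover_plane cS; move=> /(_ _ (supp mu) (fun c => ball c (h / 2))) [].
- by move=> c _; exact: ball_open.
- by move=> x Sx; exists x => //; apply: ballxx; rewrite divr_gt0.
move=> D DS Dcov.
pose D' : seq (R * R) := finmap.enum_fset D.
pose inb x c := `[< ball c (h / 2) x >].
(* By recursion on the list: index 0 means lying in the first ball, index [k.+1] means lying outside
   it with index [k] in the tail. *)
have mfind (s : seq (R * R)) k : measurable [set x | find (inb x) s = k].
  elim: s k => [|c s IHs] k /=.
    case: k => [|k]; first by rewrite (_ : [set _ | _] = setT) //; apply/seteqP; split.
    by rewrite (_ : [set _ | _] = set0) //; apply/seteqP; split.
  have mb : measurable (ball c (h / 2)) by apply: open_measurable2; exact: ball_open.
  case: k => [|k].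
    rewrite (_ : [set _ | _] = ball c (h / 2)) //; apply/seteqP; split => x /=;
      by rewrite /inb; case: asboolP.
  rewrite (_ : [set _ | _] = ~` ball c (h / 2) `&` [set x | find (inb x) s = k]).
    by apply: measurableI => //; exact: measurableC.
  apply/seteqP; split => x /=; rewrite /inb.
    by case: asboolP => [//|nb] [h']; split.
  by move=> [nb fk]; case: asboolP => [//|_]; rewrite fk.
exists (size D'), (fun k => supp mu `&` [set x | find (inb x) D' = k]), (nth 0 D').
split.
- by move=> k; apply: measurableI => //; exact: measurable_supp.
- by move=> k kD; have := DS _ (mem_nth 0 kD); rewrite inE.
move=> x Sx; have [c Dc cx] := Dcov _ Sx.
have hx : has (inb x) D' by apply/hasP; exists c => //; exact/asboolP.
exists (find (inb x) D'); split; first by rewrite -has_find.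
  by move=> k; split => [[_ <-]|->] //; split.
have := nth_find 0 hx; move=> /asboolP/cabs_toCB_lt; lra.
Qed.
End Support.

(** * Cauchy transforms of a measure and of its samples *)
Section CauchyTransform.
Context {R : realType}.
Local Notation C := R[i].
Local Notation RC := (real_complex R).
Implicit Types (x y : R * R) (z : C).

Lemma cabs_inv_close (u v : C) (rho : R) : 0 < rho -> rho <= cabs u -> rho <= cabs v ->
  cabs (u^-1 - v^-1) <= cabs (u - v) / rho ^+ 2.
Proof.
move=> r0 ru rv; have u0 : u != 0 by rewrite -cabs_gt0; lra.
have v0 : v != 0 by rewrite -cabs_gt0; lra.
have -> : u^-1 - v^-1 = (v - u) * (u^-1 * v^-1) by field; rewrite u0 v0.
rewrite !cabsM !cabsV cabsB ler_wpM2l ?cabs_ge0 // expr2 invfM.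
by apply: ler_pM; rewrite ?invr_ge0 ?cabs_ge0 // lef_pV2 ?posrE ?cabs_gt0.
Qed.

(** On nonnegative values, 0 included, the inverse is the power of exponent [-1]. *)
Lemma measurable_inv0 d (T : measurableType d) (f : T -> R) :
  (forall w, 0 <= f w) -> measurable_fun setT f ->
  measurable_fun setT (fun w => (f w)^-1).
Proof.
move=> f0 mf; rewrite (_ : (fun w => _) = (fun r => r `^ (-1)) \o f).
  by apply: measurableT_comp => //; exact: measurable_powR.
by apply/funext => w /=; rewrite powR_inv1.
Qed.

Let kernel_den z x := (complex.Re z - x.1) ^+ 2 + (complex.Im z - x.2) ^+ 2.

Let measurable_kernel_den z : measurable_fun setT (fun x => (kernel_den z x)^-1).
Proof.
apply: measurable_inv0 => [w|]; first by rewrite addr_ge0 ?sqr_ge0.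
by apply: measurable_funD; apply: measurable_funX; exact: measurable_funB.
Qed.

Lemma measurable_Re_kernel z :
  measurable_fun setT (fun x => complex.Re ((z - toC x)^-1)).
Proof.
rewrite (_ : (fun x => _) = (fun x => (complex.Re z - x.1) * (kernel_den z x)^-1)).
  apply: measurable_funM; [exact: measurable_funB|].
  exact: measurable_kernel_den.
by apply/funext => x; case: z.
Qed.

Lemma measurable_Im_kernel z :
  measurable_fun setT (fun x => complex.Im ((z - toC x)^-1)).
Proof.
rewrite (_ : (fun x => _) = (fun x => (x.2 - complex.Im z) * (kernel_den z x)^-1)).
  apply: measurable_funM; [exact: measurable_funB|].
  exact: measurable_kernel_den.
by apply/funext => x; case: z => a b /=; rewrite -mulNr opprB.
Qed.

Variable mu : probability (R * R)%type R.
Local Notation S := (supp mu).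

(** The support has full measure. With the indicator, bounds that hold only on the support become
    global, which integrability requires near the pole of the kernel. *)
Lemma Rintegral_supp (phi : R * R -> R) : measurable_fun setT phi ->
  \int[mu]_x phi x = \int[mu]_x (phi x * \1_S x).
Proof.
move=> mphi; rewrite /Rintegral; congr fine.
apply: ae_eq_integral => //.
- exact/measurable_EFinP.
- apply/measurable_EFinP; apply: measurable_funM => //.
  by apply: measurable_indic; exact: measurable_supp.
- have := supp_ae mu; apply: filterS => x Sx _ /=.
  by rewrite indicE mem_set // mulr1.
Qed.

Lemma Rintegral_supp_close (phi psi : R * R -> R) (M eta : R) :
  measurable_fun setT phi -> measurable_fun setT psi ->
  (forall x, S x -> `|phi x| <= M) -> (forall x, S x -> `|psi x| <= M) ->
  (forall x, S x -> `|phi x - psi x| <= eta) ->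
  `|\int[mu]_x phi x - \int[mu]_x psi x| <= eta.
Proof.
move=> mphi mpsi bphi bpsi close.
have mS : measurable_fun setT (\1_S : R * R -> R).
  by apply: measurable_indic; exact: measurable_supp.
have [x0 Sx0] := supp_nonempty mu.
have M0 : 0 <= M := le_trans (normr_ge0 _) (bphi x0 Sx0).
have e0 : 0 <= eta := le_trans (normr_ge0 _) (close x0 Sx0).
have bS (f : R * R -> R) (a : R) : 0 <= a -> (forall x, S x -> `|f x| <= a) ->
    forall x, `|f x * \1_S x| <= a.
  move=> a0 fa x; rewrite indicE; case: (boolP (x \in S)) => /= xS.
    by rewrite mulr1 fa //; exact: set_mem.
  by rewrite mulr0 normr0.
have iS (f : R * R -> R) (a : R) : measurable_fun setT f -> 0 <= a ->
    (forall x, S x -> `|f x| <= a) -> mu.-integrable setT (EFin \o (fun x => f x * \1_S x)).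
  by move=> mf a0 fa; apply: bounded_integrable (bS f a a0 fa); exact: measurable_funM.
rewrite (Rintegral_supp mphi) (Rintegral_supp mpsi).
rewrite -(RintegralB _ (iS _ M mphi M0 bphi) (iS _ M mpsi M0 bpsi)) //.
have iD : mu.-integrable setT (EFin \o (fun x => (phi x - psi x) * \1_S x)).
  by apply: (iS _ eta) => //; exact: measurable_funB.
under eq_Rintegral do rewrite -mulrBl.
apply: le_trans (le_normr_Rintegral _ iD) _ => //.
have icst : mu.-integrable setT (EFin \o (fun _ : R * R => eta)).
  by apply: (@bounded_integrable _ _ _ _ _ `|eta|).
have inorm : mu.-integrable setT (EFin \o (fun x => `|(phi x - psi x) * \1_S x|)).
  exact: integrable_norm iD.
apply: (@le_trans _ _ (\int[mu]_(x in setT) eta)).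
  apply: le_Rintegral => // x _.
  exact: (bS (fun x => phi x - psi x)).
by rewrite Rintegral_cst // (_ : fine (mu setT) = 1) ?mulr1 // probability_setT.
Qed.

(** The factor 2 comes from comparing real and imaginary parts separately. *)
Lemma cauchy_transform_close (phi psi : R * R -> C) (M eta : R) :
  measurable_fun setT (fun x => complex.Re (phi x)) ->
  measurable_fun setT (fun x => complex.Im (phi x)) ->
  measurable_fun setT (fun x => complex.Re (psi x)) ->
  measurable_fun setT (fun x => complex.Im (psi x)) ->
  (forall x, S x -> cabs (phi x) <= M) -> (forall x, S x -> cabs (psi x) <= M) ->
  (forall x, S x -> cabs (phi x - psi x) <= eta) ->
  cabs (Complex (\int[mu]_x complex.Re (phi x)) (\int[mu]_x complex.Im (phi x)) -
        Complex (\int[mu]_x complex.Re (psi x)) (\int[mu]_x complex.Im (psi x)))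
    <= 2 * eta.
Proof.
move=> m1 m2 m3 m4 b1 b2 close; apply: le_trans (cabs_le _) _ => /=.
have -> : 2 * eta = eta + eta by ring.
apply: lerD; apply: (@Rintegral_supp_close _ _ M) => // x Sx;
  rewrite -?raddfB.
all: by [apply: le_trans (Re_le_cabs _) _; auto | apply: le_trans (Im_le_cabs _) _; auto].
Qed.

(** Distance from the support alone, which controls the kernel; unlike in the complement of [Nmu],
    zeros of the Cauchy transform are allowed. *)
Definition far (r : R) z := forall x, S x -> r <= cabs (z - toC x).

Lemma cabs_kernel_le r z x : 0 < r -> far r z -> S x -> cabs (z - toC x)^-1 <= r^-1.
Proof.
move=> r0 fz Sx; have h := fz x Sx; rewrite cabsV lef_pV2 ?posrE //.
exact: lt_le_trans h.
Qed.

Lemma cauchy_transform_lipschitz r z z' : 0 < r -> far r z -> far r z' ->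
  cabs (cauchy_transform mu z - cauchy_transform mu z') <= 2 * (cabs (z - z') / r ^+ 2).
Proof.
move=> r0 fz fz'.
apply: (@cauchy_transform_close (fun x => (z - toC x)^-1) (fun x => (z' - toC x)^-1) r^-1).
- exact: measurable_Re_kernel.
- exact: measurable_Im_kernel.
- exact: measurable_Re_kernel.
- exact: measurable_Im_kernel.
- by move=> x; exact: cabs_kernel_le.
- by move=> x; exact: cabs_kernel_le.
- move=> x Sx; apply: le_trans (cabs_inv_close r0 (fz x Sx) (fz' x Sx)) _.
  by rewrite (_ : z - toC x - (z' - toC x) = z - z') //; ring.
Qed.

Section Partition.
Variables (h r : R) (m : nat) (E : nat -> set (R * R)) (e : nat -> R * R).
Hypotheses (r0 : 0 < r) (mE : forall k, measurable (E k)).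
Hypothesis eS : forall k, (k < m)%N -> S (e k).
Hypothesis Ecov : forall x, S x -> exists k0, [/\ (k0 < m)%N,
  (forall k, E k x <-> k = k0) & cabs (toC (e k0) - toC x) <= h].

(** The kernel with its pole moved to the representative of the cell of [x]. Its averages involve
    only cell frequencies, and the cells do not depend on [z]. *)
Let step z x : C := \sum_(k < m) RC (\1_(E k) x) * (z - toC (e k))^-1.

Lemma step_cell z x : S x -> exists k0, [/\ (k0 < m)%N,
  step z x = (z - toC (e k0))^-1 & cabs (toC (e k0) - toC x) <= h].
Proof.
move=> /Ecov[k0 [k0m Ek0 d0]]; exists k0; split => //.
rewrite /step (bigD1 (Ordinal k0m)) //= big1 => [|k kk0].
  by rewrite addr0 indicE mem_set ?mul1r //; exact/Ek0.
rewrite indicE memNset ?mul0r // => /Ek0 kE.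
by move: kk0; rewrite -val_eqE /= kE eqxx.
Qed.

Lemma step_close z x : far r z -> S x ->
  cabs ((z - toC x)^-1 - step z x) <= h / r ^+ 2.
Proof.
move=> fz Sx; have [k0 [k0m -> d0]] := step_cell z Sx.
apply: le_trans (cabs_inv_close r0 (fz x Sx) (fz _ (eS k0m))) _.
rewrite ler_pM2r ?invr_gt0 ?exprn_gt0 //.
by rewrite (_ : z - toC x - (z - toC (e k0)) = toC (e k0) - toC x) //; ring.
Qed.

Let Re_step z x : complex.Re (step z x) =
  \sum_(k < m) (\1_(E k) x * complex.Re (z - toC (e k))^-1).
Proof.
rewrite /step raddf_sum; apply: eq_bigr => k _.
by move: ((_ - _)^-1) => [a b] /=; rewrite mul0r subr0.
Qed.

Let Im_step z x : complex.Im (step z x) =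
  \sum_(k < m) (\1_(E k) x * complex.Im (z - toC (e k))^-1).
Proof.
rewrite /step raddf_sum; apply: eq_bigr => k _.
by move: ((_ - _)^-1) => [a b] /=; rewrite mul0r addr0.
Qed.

Let integrable_cell k (a : R) :
  mu.-integrable setT (EFin \o (fun x => \1_(E k) x * a)).
Proof.
apply: (@bounded_integrable _ _ _ _ _ `|a|).
  by apply: measurable_funM => //; exact: measurable_indic.
by move=> x; rewrite indicE; case: (_ \in _); rewrite ?mul1r ?mul0r ?normr0.
Qed.

Let Rintegral_cells (a : 'I_m -> R) :
  \int[mu]_x (\sum_(k < m) (\1_(E k) x * a k)) = \sum_(k < m) fine (mu (E k)) * a k.
Proof.
rewrite Rintegral_sum => [|k]; last exact: integrable_cell.
apply: eq_bigr => k _.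
under eq_Rintegral do rewrite mulrC.
rewrite RintegralZl //; last first.
  by have := @integrable_cell k 1; apply: eq_integrable => // x _ /=; rewrite mulr1.
by rewrite mulrC /Rintegral integral_indic // setIT.
Qed.

Lemma cauchy_transform_step z : far r z ->
  cabs (cauchy_transform mu z -
        \sum_(k < m) RC (fine (mu (E k))) * (z - toC (e k))^-1) <= 2 * (h / r ^+ 2).
Proof.
move=> fz.
have -> : \sum_(k < m) RC (fine (mu (E k))) * (z - toC (e k))^-1 =
    Complex (\int[mu]_x complex.Re (step z x)) (\int[mu]_x complex.Im (step z x)).
  under eq_Rintegral do rewrite Re_step.
  under [X in Complex _ X]eq_Rintegral do rewrite Im_step.
  rewrite !Rintegral_cells; apply/eqP; rewrite eq_complex !raddf_sum /=.
  apply/andP; split; apply/eqP; apply: eq_bigr => k _;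
    by move: ((_ - _)^-1) => [a b] /=; rewrite mul0r ?subr0 ?addr0.
have mstep (a : 'I_m -> R) : measurable_fun setT (fun x => \sum_(k < m) (\1_(E k) x * a k)).
  apply: measurable_sum => k.
  have mI : measurable_fun setT (\1_(E k) : R * R -> R) by exact: measurable_indic.
  by apply: measurable_funM => //; exact: measurable_cst.
apply: (@cauchy_transform_close (fun x => (z - toC x)^-1) (step z) r^-1).
- exact: measurable_Re_kernel.
- exact: measurable_Im_kernel.
- by rewrite (funext (Re_step z)).
- by rewrite (funext (Im_step z)).
- by move=> x; exact: cabs_kernel_le.
- move=> x Sx; have [k0 [k0m -> _]] := step_cell z Sx.
  exact: cabs_kernel_le (eS k0m).
- by move=> x; exact: step_close.
Qed.

(** Three errors add up: kernel to step function on the samples, [h / r ^+ 2]; empirical to true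
    cell frequencies, [m * eta / r]; integral of the step function to the Cauchy transform,
    [2 * (h / r ^+ 2)]. *)
Lemma empirical_step (X : nat -> R * R) n z (eta : R) : 0 <= eta -> far r z ->
  (forall j, S (X j)) ->
  (forall k, (k < m)%N ->
     `|\sum_(j < n) (\1_(E k) (X j) - fine (mu (E k)))| <= eta * n%:R) ->
  cabs (\sum_(j < n) (z - toC (X j))^-1 - n%:R * cauchy_transform mu z) <=
    (3 * (h / r ^+ 2) + m%:R * eta / r) * n%:R.
Proof.
move=> eta0 fz XS Xfreq.
have e1 : cabs (\sum_(j < n) ((z - toC (X j))^-1 - step z (X j))) <= h / r ^+ 2 * n%:R.
  apply: le_trans (cabs_sum _ _ _) _.
  rewrite mulr_natr -[n in leRHS]card_ord -sumr_const.
  by apply: ler_sum => j _; exact: step_close.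
have e2 : cabs (\sum_(k < m) RC (\sum_(j < n) (\1_(E k) (X j) - fine (mu (E k)))) *
     (z - toC (e k))^-1) <= m%:R * eta / r * n%:R.
  apply: le_trans (cabs_sum _ _ _) _.
  rewrite (_ : m%:R * eta / r * n%:R = (eta * n%:R * r^-1) *+ m); last first.
    by rewrite -mulr_natr; ring.
  rewrite -[m in leRHS]card_ord -sumr_const.
  apply: ler_sum => k _; rewrite cabsM cabs_real.
  apply: ler_pM; rewrite ?cabs_ge0 // ?Xfreq //.
  exact: cabs_kernel_le (eS (ltn_ord k)).
have e3 := cauchy_transform_step fz.
have -> : \sum_(j < n) (z - toC (X j))^-1 - n%:R * cauchy_transform mu z =
  \sum_(j < n) ((z - toC (X j))^-1 - step z (X j)) +
  (\sum_(k < m) RC (\sum_(j < n) (\1_(E k) (X j) - fine (mu (E k)))) * (z - toC (e k))^-1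
  - n%:R * (cauchy_transform mu z -
        \sum_(k < m) RC (fine (mu (E k))) * (z - toC (e k))^-1)).
  rewrite sumrB.
  have -> : \sum_(k < m) RC (\sum_(j < n) (\1_(E k) (X j) - fine (mu (E k)))) * (z - toC (e k))^-1
     = \sum_(j < n) step z (X j) - n%:R * \sum_(k < m) RC (fine (mu (E k))) * (z - toC (e k))^-1.
    rewrite /step exchange_big /= mulr_sumr -sumrB; apply: eq_bigr => k _.
    rewrite sumrB sumr_const card_ord rmorphB rmorph_sum rmorphMn /= mulrBl mulr_suml.
    by rewrite -mulr_natl mulrA.
  by ring.
apply: le_trans (cabsD _ _) _.
apply: le_trans (lerD e1 (cabsD _ _)) _.
rewrite cabsN cabsM.
have -> : cabs (n%:R : C) = n%:R.
  by rewrite (_ : n%:R = RC n%:R) ?cabs_real ?normr_nat // rmorph_nat.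
have : n%:R * cabs (cauchy_transform mu z -
   \sum_(k < m) RC (fine (mu (E k))) * (z - toC (e k))^-1) <= n%:R * (2 * (h / r ^+ 2)).
  by rewrite ler_wpM2l.
move: e2; move: (h / _) (m%:R * eta / r) => a b; lra.
Qed.
End Partition.
End CauchyTransform.

(** * Uniform estimates away from the support and the zeros *)

Section AlmostSure.
Context {R : realType}.
Local Notation C := R[i].
Variable mu : probability (R * R)%type R.

Lemma far_Nmu r z : ~ Nmu mu r z -> far mu r z.
Proof.
move=> nz x Sx; rewrite leNgt; apply/negP => h; apply: nz.
by exists (toC x); split => //; left; exists x.
Qed.

Lemma cauchy_transform_neq0 r z : 0 < r -> ~ Nmu mu r z -> cauchy_transform mu z != 0.
Proof.
move=> r0 nz; apply/eqP => m0.
case: (pselect (suppC mu z)) => zS; apply: nz; exists z; rewrite subrr cabs0.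
  by split => //; left.
by split => //; right; split.
Qed.

Lemma open_Nmu r : open [set x : R * R | Nmu mu r (toC x)].
Proof.
rewrite openE => x [y [yS xy]]; apply/nbhs_ballP.
exists ((r - cabs (toC x - y)) / 2); first by rewrite /= divr_gt0 // subr_gt0.
move=> x' /cabs_toCB_lt xx'; exists y; split => //.
have := cabs_triangle (toC x) (toC x') y; rewrite (cabsB (toC x') (toC x)); lra.
Qed.

Lemma seq_pos_lower_bound (T : eqType) (s : seq T) (v : T -> R) :
  (forall a, 0 < v a) -> exists2 c, 0 < c & forall a, a \in s -> c <= v a.
Proof.
move=> v0; elim: s => [|a s [c c0 cs]]; first by exists 1.
exists (Num.min c (v a)); first by rewrite lt_min c0 v0.
by move=> a'; rewrite inE => /predU1P[->|/cs h]; rewrite ge_min ?lexx ?orbT ?h.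
Qed.

(** The modulus is positive on a compact set, a square minus the open neighbourhood. Around each
    point it keeps at least half of its value by the Lipschitz estimate, and a finite subcover gives
    a common bound. *)
Lemma cauchy_transform_lower_bound r (B : R) : 0 < r ->
  exists2 c, 0 < c & forall z, cabs z <= B -> ~ Nmu mu r z ->
    c <= cabs (cauchy_transform mu z).
Proof.
move=> r0.
pose A : set (R * R) := (`[-B, B] `*` `[-B, B]) `&` ~` [set x | Nmu mu r (toC x)].
have cA : compact A.
  apply: compact_closedI; first by apply: compact_setX; exact: segment_compact.
  by apply: open_closedC; exact: open_Nmu.
pose v (x : R * R) := cabs (cauchy_transform mu (toC x)).
have vA x : A x -> 0 < v x.
  by move=> [_ nx]; rewrite cabs_gt0; exact: cauchy_transform_neq0 nx.
(* Points of the ball are within [2 * del x], so the Lipschitz constant [2 / r ^+ 2] allows a change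
   of at most [v x / 2]. *)
pose del (x : R * R) := v x * r ^+ 2 / 8.
have [|x Ax|D DA Dcov] := compact_cover_plane cA (D := A) (f := fun x => ball x (del x)).
- by move=> x _; exact: ball_open.
- exists x => //; apply: ballxx; rewrite divr_gt0 // mulr_gt0 ?exprn_gt0 //.
  exact: vA.
(* The value 1 off [A] makes [v'] positive everywhere. *)
pose v' x := if `[< A x >] then v x / 2 else 1.
have [|c c0 cD] := @seq_pos_lower_bound _ (finmap.enum_fset D) v'.
  by move=> x; rewrite /v'; case: asboolP => // /vA h; rewrite divr_gt0.
exists c => // z zB nz; case: z zB nz => a b zB nz.
have Ax : A (a, b).
  split; last exact: nz.
  have := le_trans (Re_le_cabs _) zB; have := le_trans (Im_le_cabs _) zB => /=.
  by rewrite !ler_norml => h1 h2; split; rewrite /= in_itv.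
have [y yD xy] := Dcov _ Ax.
have Ay : A y by have := DA _ yD; rewrite inE.
have : c <= v' y by apply: cD.
rewrite /v' asboolT // => /le_trans; apply.
have [_ /far_Nmu fy] := Ay; have [_ /far_Nmu fx] := Ax.
have mB := cauchy_transform_lipschitz r0 fy fx.
have xyB : cabs (toC y - toC (a, b)) / r ^+ 2 <= v y / 4.
  rewrite ler_pdivrMr ?exprn_gt0 //; apply: le_trans (ltW (cabs_toCB_lt xy)) _.
  by rewrite /del; lra.
have := cabs_triangle (cauchy_transform mu (toC (a, b))) (cauchy_transform mu (toC y)) 0.
rewrite !subr0 -/(v y) -[toC (a, b)]/(Complex a b) in mB xyB *; lra.
Qed.

Context {d} {T : measurableType d} (P : probability T R) (X : nat -> T -> R * R).
Hypothesis iidX : iid_with P mu X.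

Let mX i A : measurable A -> measurable (X i @^-1` A).
Proof. by move=> mA; rewrite -(setTI (_ @^-1` _)); apply: (iidX.1 i). Qed.

Lemma iid_law i A : measurable A -> P (X i @^-1` A) = mu A.
Proof.
move=> mA; have := iidX.2 [:: i] (fun=> A) erefl (fun=> mA).
rewrite big_seq1 fineK ?fin_num_measure // => <-; congr (P _).
by apply/seteqP; split => [w h j /=|w h]; [rewrite inE => /eqP->|apply: h; rewrite /= inE].
Qed.

Lemma iid_law2 i j A : i != j -> measurable A ->
  P (X i @^-1` A `&` X j @^-1` A) = (fine (mu A) * fine (mu A))%:E.
Proof.
move=> ij mA; have := iidX.2 [:: i; j] (fun=> A).
rewrite /= inE ij big_cons big_seq1 => /(_ erefl (fun=> mA)) <-; congr (P _).
apply/seteqP; split => [w [h1 h2] l /=|w h]; first by rewrite !inE => /orP[]/eqP->.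
by split; apply: h; rewrite /= !inE eqxx ?orbT.
Qed.

Lemma iid_in_supp : {ae P, forall w, forall j, supp mu (X j w)}.
Proof.
have mC : measurable (~` supp mu) by exact: measurableC (measurable_supp mu).
apply: ae_foralln => j; exists (X j @^-1` (~` supp mu)); split => //.
  exact: mX.
have := iid_law j mC; rewrite (probability_setC mu); last exact: measurable_supp.
by rewrite probability_supp subee.
Qed.

(** The law of large numbers is applied to the countably many cells [E k], so one null set serves
    all [z], and the threshold [N] is uniform in [z]. *)
Lemma empirical_cauchy (r theta : R) : compact (supp mu) -> 0 < r -> 0 < theta ->
  {ae P, forall w, exists N, forall n z, (N <= n)%N -> far mu r z ->
    cabs (\sum_(j < n) (z - toC (X j w))^-1 - n%:R * cauchy_transform mu z)
      <= theta * n%:R}.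
Proof.
move=> cS r0 t0; have r20 : 0 < r ^+ 2 by rewrite exprn_gt0.
(* Both [h] and [eta] below are set to spend half of [theta] each; [m.+1] in [eta] keeps the
   denominator nonzero. *)
pose h := theta * r ^+ 2 / 6.
have h0 : 0 < h by rewrite divr_gt0 // mulr_gt0.
have [m [E [e [mE eS Ecov]]]] := supp_partition cS h0.
pose eta := theta * r / (2 * m.+1%:R).
have eta0 : 0 < eta by rewrite divr_gt0 // mulr_gt0.
have freq k : {ae P, forall w, forall e, 0 < e -> exists N, forall n, (N <= n)%N ->
    `|\sum_(j < n) (\1_(E k) (X j w) - fine (mu (E k)))| <= e * n%:R}.
  apply: (@bernoulli_lln _ _ _ P (fun j => X j @^-1` E k)).
  - by move=> j; exact: mX.
  - by move=> j; rewrite iid_law // fineK // fin_num_measure.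
  - by move=> i j ij; rewrite iid_law2.
apply: filterS2 iid_in_supp (ae_foralln freq) => w XS fw.
have [N NP] : exists N, forall k, (k < m)%N -> forall n, (N <= n)%N ->
    `|\sum_(j < n) (\1_(E k) (X j w) - fine (mu (E k)))| <= eta * n%:R.
  elim: (m) => [|m' [N NP]]; first by exists 0%N.
  have [N' N'P] := fw m' eta eta0.
  exists (maxn N N') => k; rewrite ltnS leq_eqVlt => /predU1P[->|km] n.
    by rewrite geq_max => /andP[_]; exact: N'P.
  by rewrite geq_max => /andP[+ _]; exact: NP.
exists N => n z Nn fz.
apply: le_trans (empirical_step r0 mE eS Ecov (ltW eta0) fz XS _) _.
  by move=> k km; exact: NP.
apply: ler_wpM2r => //.
have -> : 3 * (h / r ^+ 2) = theta / 2 by rewrite /h; field; rewrite gt_eqF.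
suff : m%:R * eta / r <= theta / 2 by lra.
have -> : m%:R * eta / r = theta / 2 * (m%:R / m.+1%:R).
  have : m.+1%:R != 0 :> R by rewrite pnatr_eq0.
  rewrite /eta; move: (m.+1%:R : R) => m1 m10; field.
  by rewrite m10 gt_eqF.
by rewrite ger_pMr ?divr_gt0 // ler_pdivrMr // mul1r ler_nat.
Qed.
End AlmostSure.

(** * From neighbourhoods of the support to labelled critical points *)

Section Labeling.
Context {R : realType}.
Local Notation C := R[i].
Variable mu : probability (R * R)%type R.

Lemma Nmu_sub r r' z : r <= r' -> Nmu mu r z -> Nmu mu r' z.
Proof. by move=> rr [y [yS zy]]; exists y; split => //; exact: lt_le_trans rr. Qed.

Lemma Nmu_triangle r r' z z' : cabs (z - z') <= r' -> Nmu mu r z -> Nmu mu (r + r') z'.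
Proof.
move=> zz [y [yS zy]]; exists y; split => //.
have := cabs_triangle z z' y; rewrite (cabsB z' z); lra.
Qed.

(** The term [k / eps] in the lower bound pays for the roots [y l] with [s <= l], which are moved
    into the group of the samples. The bound [eps] on [4 * delta * s + delta] keeps the tracked
    roots, which start outside radius [3 * eps], outside radius [2 * eps]. *)
Lemma labeling_near (x : nat -> R * R) (y : nat -> C) (n k s : nat)
    (eps delta c0 B0 : R) :
  0 < eps -> 0 < delta -> (s <= k)%N -> (0 < n)%N ->
  (forall j, supp mu (x j)) -> (forall j, cabs (toC (x j)) <= B0) ->
  (forall l, (l < k)%N -> cabs (y l) <= B0) ->
  (forall l, (l < s)%N -> ~ Nmu mu (3 * eps) (y l)) ->
  (forall l, (s <= l < k)%N -> Nmu mu eps (y l)) ->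
  (forall z, ~ Nmu mu (2 * eps) z -> cabs z <= B0 ->
     c0 + k%:R / eps <= cabs (\sum_(j < n) (z - toC (x j))^-1)) ->
  s%:R < c0 * delta -> 4 * delta * s%:R + delta <= eps ->
  exists ws, critical_labeling
      ((\prod_(j < n) ('X - (toC (x j))%:P)) * (\prod_(l < k) ('X - (y l)%:P)))
      mu (2 * eps) s ws /\
    forall l, (l < s)%N -> cabs (ws`_l - y l) <= 4 * delta * s%:R.
Proof.
move=> eps0 d0 sk n0 xS xB yB y_out y_in big sc d_small.
pose S := mkseq y s; pose U := [seq y l | l <- index_iota s k].
pose V := mkseq (fun j => toC (x j)) n.
have sS : size S = s by rewrite size_mkseq.
have SE l : (l < s)%N -> S`_l = y l by move=> ls; rewrite nth_mkseq.
have UP w : w \in U -> exists2 l, (s <= l < k)%N & w = y l.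
  by move=> /mapP[l]; rewrite mem_index_iota; exists l.
have VP w : w \in V -> exists j, w = toC (x j) by move=> /mapP[j _]; exists j.
have pE : (\prod_(j < n) ('X - (toC (x j))%:P)) * (\prod_(l < k) ('X - (y l)%:P)) =
    \prod_(w <- S ++ V ++ U) ('X - w%:P).
  rewrite !big_cat !big_map /= mulrCA; congr (_ * _).
    by rewrite -(big_mkord xpredT (fun j => 'X - (toC (x j))%:P)) /index_iota subn0.
  rewrite -(big_mkord xpredT (fun l => 'X - (y l)%:P)) (big_cat_nat _ sk) //=.
  by rewrite /index_iota subn0.
have [||w||z nz zB|w|l z ls|ws [sws wout p0 mult close]] := @critical_points_track R S (V ++ U) B0 c0 delta
   (fun z => ~ Nmu mu (2 * eps) z).
- exact: d0.
- by rewrite -size_eq0 size_cat size_mkseq addn_eq0 negb_and -lt0n n0.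
- rewrite !mem_cat => /or3P[/mapP[l]|/VP[j ->//]|/UP[l /andP[_ lk] ->]]; last exact: yB.
  by rewrite mem_iota => /andP[_ ls] ->; apply: yB; apply: leq_trans sk.
- by rewrite sS.
- rewrite big_cat /= big_map.
  have h := big z nz zB.
  have -> : \sum_(j <- iota 0 n) (z - toC (x j))^-1 = \sum_(j < n) (z - toC (x j))^-1.
    by rewrite -(big_mkord xpredT (fun j => (z - toC (x j))^-1)) /index_iota subn0.
  (* A point outside radius [2 * eps] is at least [eps] away from any point inside radius [eps]. *)
  have : cabs (\sum_(w <- U) (z - w)^-1) <= k%:R / eps.
    apply: le_trans (cabs_sum _ _ _) _; rewrite big_map.
    apply: (@le_trans _ _ (\sum_(s <= l < k) eps^-1)).
      rewrite !big_nat; apply: ler_sum => l lk.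
      rewrite cabsV; have : eps <= cabs (z - y l).
        rewrite leNgt; apply/negP => zy; apply: nz.
        have -> : 2 * eps = eps + eps by ring.
        by apply: Nmu_triangle (y_in l lk); rewrite cabsB ltW.
      by move=> e1; rewrite lef_pV2 ?posrE //; exact: lt_le_trans e1.
    rewrite sumr_const_nat -[leLHS]mulr_natl ler_wpM2r ?invr_ge0 ?(ltW eps0) //.
    by rewrite ler_nat leq_subr.
  set a := \sum_(_ < _) _ in h *; set b := \sum_(_ <- U) _ => hb.
  have := cabsD (a + b) (- b); rewrite addrK cabsN; lra.
- rewrite mem_cat => /orP[/VP[j ->]|/UP[l lk ->]]; apply.
    exists (toC (x j)); split; first by left; exists (x j).
    by rewrite subrr cabs0 mulr_gt0.
  by apply: Nmu_sub (y_in l lk); lra.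
- rewrite sS in ls *; rewrite SE // => zy nz; apply: (y_out l ls).
  have -> : 3 * eps = 2 * eps + eps by ring.
  by apply: Nmu_triangle nz; lra.
exists ws; split.
  by rewrite pE; split => //; rewrite sws.
by move=> l ls; rewrite -SE // -sS; apply: close; rewrite sS.
Qed.
End Labeling.

(** * Almost sure pairing of critical points with outlying roots *)

Unset Implicit Arguments.

Theorem mainTheorem5 (R : realType) (d : measure_display) (T : measurableType d)
  (P : probability T R) (mu : probability (R * R)%type R)
  (X : nat -> T -> R * R) (k : nat -> nat) (xi : nat -> nat -> R[i])
  (K : nat) (B eps : R) (s : nat) :
  compact (supp mu) ->
  iid_with P mu X ->
  (forall n, (k n <= K)%N) ->
  (forall n l, (l < k n)%N -> cabs (xi n l) <= B) ->
  0 < eps ->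
  (exists N, forall n, (N <= n)%N ->
     [/\ (s <= k n)%N,
         (forall l, (l < k n)%N ->
            ~ (Nmu mu (3 * eps) (xi n l) /\ ~ Nmu mu eps (xi n l))),
         (forall l, (l < s)%N -> ~ Nmu mu (3 * eps) (xi n l)) &
         (forall l, (s <= l < k n)%N -> Nmu mu eps (xi n l))]) ->
  {ae P, forall w : T, exists (N : nat) (wl : nat -> seq R[i]),
     (forall n, (N <= n)%N -> critical_labeling (pn X k xi n w) mu (2 * eps) s (wl n)) /\
     ((fun n => \big[Num.max/0]_(l < s) cabs ((wl n)`_l - xi n l)) @ \oo --> (0 : R))}.
Proof.
move=> cS iidX kK xiB eps0 [N0 N0P].
have eps20 : 0 < 2 * eps by rewrite mulr_gt0.
have [BS BSP] : exists BS : R, forall x, supp mu x -> cabs (toC x) <= BS.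
  have [M [_ MP]] := compact_bounded cS.
  exists (2 * (M + 1)) => x Sx; have M1 : M < M + 1 by rewrite ltrDl.
  have : `|x| <= M + 1 := MP (M + 1) M1 x Sx.
  rewrite prod_normE ge_max => /andP[x1 x2].
  apply: le_trans (cabs_le _) _ => /=; lra.
(* A disc containing all roots, hence all critical points. *)
pose B0 := Num.max BS B.
have [c c0 cP] := cauchy_transform_lower_bound mu B0 eps20.
have c20 : 0 < c / 2 by rewrite divr_gt0.
have := empirical_cauchy iidX cS eps20 c20.
have := iid_in_supp iidX; apply: filterS2 => w XS [N1 N1P].
(* With lower bound [c * n / 4] on the logarithmic derivative, the product with [delta n] is
   [2 * s.+1], above [s], while [delta n] is of order [1 / n]. *)
pose delta n : R := 8 * s.+1%:R / (c * n%:R).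
pose Q n ws := critical_labeling (pn X k xi n w) mu (2 * eps) s ws /\
  forall l, (l < s)%N -> cabs (ws`_l - xi n l) <= 4 * delta n * s%:R.
have [N NP] : exists N, forall n, (N <= n)%N -> exists ws, Q n ws.
  have BS0 : 0 <= B0.
    have [x0 Sx0] := supp_nonempty mu.
    by rewrite le_max (le_trans (cabs_ge0 _) (BSP x0 Sx0)).
  (* For [n >= A], the bound [(n - k n) * c / 2] on the sample sum exceeds [c * n / 4 + k n / eps];
     for [n >= A'], [4 * delta n * s + delta n] is at most [eps]. *)
  pose A : R := 2 * K%:R + 4 * K%:R / (c * eps).
  pose A' : R := 8 * s.+1%:R * (4 * s%:R + 1) / (c * eps).
  (* The term [(N1 + K).+1] makes the number [n - k n] of samples positive and at least [N1]. *)
  exists (maxn (maxn N0 (N1 + K).+1) (maxn (Num.truncn A).+1 (Num.truncn A').+1)) => n.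
  rewrite !geq_max => /andP[/andP[n0 n1] /andP[nA nA']].
  have [sk _ y_out y_in] := N0P n n0.
  have nK : (k n <= n)%N.
    exact: leq_trans (kK n) (ltnW (leq_ltn_trans (leq_addl N1 K) n1)).
  have kn : (k n)%:R <= K%:R :> R by rewrite ler_nat.
  have npos : 0 < n%:R :> R by rewrite ltr0n; case: (n) n1.
  have An : A <= n%:R by apply: ltW; apply: lt_le_trans (truncnS_gt _) _; rewrite ler_nat.
  have A'n : A' <= n%:R by apply: ltW; apply: lt_le_trans (truncnS_gt _) _; rewrite ler_nat.
  have dpos : 0 < delta n by rewrite divr_gt0 // ?mulr_gt0.
  apply: (@labeling_near _ mu (X^~ w) (xi n) (n - k n) (k n) s eps (delta n) (c * n%:R / 4) B0) => //.
  - rewrite subn_gt0; apply: leq_ltn_trans (kK n) _.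
    exact: leq_ltn_trans (leq_addl N1 K) n1.
  - by move=> j; rewrite le_max BSP.
  - by move=> l lk; rewrite le_max (xiB _ _ lk) orbT.
  - move=> z nz zB.
    have nN1 : (N1 <= n - k n)%N.
      rewrite leq_subRL // addnC; apply: leq_trans (ltnW n1).
      by rewrite leq_add2l.
    have emp := N1P (n - k n)%N z nN1 (far_Nmu nz).
    have cz := cP z zB nz.
    set G := \sum_(_ < _) _ in emp *; set m := cauchy_transform mu z in emp cz.
    have := cabs_triangle G ((n - k n)%:R * m) 0; rewrite !subr0 cabsB cabsM.
    have -> : cabs ((n - k n)%:R : R[i]) = (n - k n)%:R.
      rewrite (_ : (n - k n)%:R = real_complex R (n - k n)%:R); last by rewrite rmorph_nat.
      by rewrite cabs_real normr_nat.
    have : (n - k n)%:R * c <= (n - k n)%:R * cabs m by rewrite ler_wpM2l.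
    have kE : (n - k n)%:R = n%:R - (k n)%:R :> R by rewrite natrB.
    move: emp; rewrite !kE => emp h1 h2.
    have h3 : 4 * K%:R / (c * eps) = 4 / c * (K%:R / eps).
      by field; rewrite !gt_eqF.
    have h4 : (k n)%:R / eps <= K%:R / eps by rewrite ler_pM2r ?invr_gt0.
    have h5 : c * A = 2 * (c * K%:R) + 4 * (K%:R / eps).
      by rewrite /A h3; field; rewrite !gt_eqF.
    have h6 : c * A <= c * n%:R by rewrite ler_pM2l.
    have h7 : c * (k n)%:R <= c * K%:R by rewrite ler_pM2l.
    move: h1 h2 h4 h5 h6 h7 emp; move: (_ / eps) (_ / eps) => u v.
    lra.
  - have -> : c * n%:R / 4 * delta n = 2 * s.+1%:R.
      by rewrite /delta; field; rewrite !gt_eqF.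
    by rewrite -natr1; have : 0 <= s%:R :> R by []; lra.
  - have -> : 4 * delta n * s%:R + delta n = eps * A' / n%:R.
      by rewrite /delta /A'; field; rewrite !gt_eqF.
    by rewrite ler_pdivrMr // ler_pM2l.
(* Stated for every [n], with an empty list below [N], so that choice yields a total labelling. *)
have ex n : exists ws, (N <= n)%N -> Q n ws.
  by case: (leqP N n) => [/NP[ws h]|_]; [exists ws|exists [::]].
have [wl wlP] := choice ex; exists N, wl; split.
  by move=> n Nn; have [] := wlP n Nn.
apply/cvgrPdist_le => e e0.
(* The threshold beyond which [4 * delta n * s <= e]. *)
pose A : R := 4 * 8 * s.+1%:R * s%:R / (c * e).
exists (maxn N (Num.truncn A).+1) => // n /=; rewrite geq_max => /andP[Nn nA].
have An : A <= n%:R by apply: ltW; apply: lt_le_trans (truncnS_gt _) _; rewrite ler_nat.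
have npos : 0 < n%:R :> R by rewrite ltr0n (leq_trans _ nA).
rewrite sub0r normrN ger0_norm; last by apply: bigmax_ge_id.
apply: bigmax_le => [|l _]; first exact: ltW.
have [_ close] := wlP n Nn; apply: le_trans (close l (ltn_ord l)) _.
have -> : 4 * delta n * s%:R = e * A / n%:R.
  by rewrite /delta /A; field; rewrite !gt_eqF.
by rewrite ler_pdivrMr // ler_pM2l.
Qed.
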